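(* Consider the stochastic gradient tracking iteration described in the context with stepsize $\alpha$, under the function, network and gradient-noise assumptions of the context (convex case $\mu=0$). If $$0<\alpha\le\alpha_{\rm cvx}:=\frac{\delta}{\sqrt{480}\,L\sqrt Q},$$ then, for every $K\ge1$, $$\frac1K\sum_{k=0}^{K-1}\left(\mathbb{E}[f(\bar x^k)-f(x^\star)]+\frac{L}{N}\mathbb{E}\|\widehat{\mathbf x}^k\|^2\right)\le\frac{8\widetilde X_0}{3\alpha K}+\frac{40LE_0}{\delta K}+\frac{8\alpha\sigma^2}{3N}+\frac{40\alpha^2QL\sigma^2}{\delta}.$$
   Context: **Problem and algorithm.** $N,d\ge1$ are integers; agent $i\in\{1,\dots,N\}$ has a differentiable objective $f_i:\mathbb{R}^d\to\mathbb{R}$, $f_i(x)=\mathbb{E}[F_i(x;\xi_i)]$, and $f=\frac1N\sum_{i=1}^N f_i$. $\nabla F_i(x;\xi)$ is the stochastic gradient in $x$. Given mixing matrices $W_k=(w_{ij}^k)\in\mathbb{R}^{N\times N}$, stepsize $\alpha>0$, initial points $x_i^0\in\mathbb{R}^d$ and $g_i^0=\nabla F_i(x_i^0;\xi_i^0)$, stochastic gradient tracking is, for $k\ge0$, $$x_i^{k+1}=\sum_{j=1}^N w_{ij}^k(x_j^k-\alpha g_j^k),\qquad g_i^{k+1}=\sum_{j=1}^N w_{ij}^k g_j^k+\nabla F_i(x_i^{k+1};\xi_i^{k+1})-\nabla F_i(x_i^k;\xi_i^k).$$ **Function assumption (convex case).** Each $f_i$ is convex and $L$-smooth (gradient $L$-Lipschitz),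 $L>0$. $f$ admits a minimizer; $x^\star$ is any (fixed) minimizer of $f$. **Network assumption.** $\{W_k\}_{k\ge0}$ is deterministic and each $W_k$ is nonnegative and doubly stochastic ($W_k\mathbf 1=\mathbf 1$, $\mathbf 1^{\mathsf T}W_k=\mathbf 1^{\mathsf T}$). With $\Pi=\frac1N\mathbf 1\mathbf 1^{\mathsf T}$ and $\widetilde W_k=W_k-\Pi$, there are an integer $\tau\ge1$ and $\lambda\in[0,1)$ with $\|\widetilde W_{k+\tau-1}\cdots\widetilde W_k\|_2\le\lambda$ for all $k\ge0$. Let $\Delta_\lambda=1-\lambda$. **Gradient-noise assumption.** $\mathcal F^k$ is the information ($\sigma$-algebra) available immediately before the samples $\xi_1^k,\dots,\xi_N^k$ are drawn; it contains the initialization and all iterates and samples generated up to iteration $k-1$ (so $x_i^k$ is $\mathcal F^k$-measurable). Conditioned on $\mathcal F^k$, the samples $\xi_1^k,\dots,\xi_N^k$ are mutually independent and, for every $i$, $\mathbb{E}[\nabla F_i(x_i^k;\xi_i^k)-\nabla f_i(x_i^k)\mid\mathcal F^k]=0$ and $\mathbb{E}[\|\nabla F_i(x_i^k;\xi_i^k)-\nabla f_i(x_i^k)\|^2\mid\mathcal F^k]\le\sigma^2$. The initial iterates $x_i^0$ are deterministic. **Notation.** Stack $\mathbf x^k=\mathrm{col}\{x_1^k,\dots,x_N^k\}$, $\mathbf g^k=\mathrm{col}\{g_i^k\}$, $\nabla\mathbf F(\mathbf x^k;\boldsymbol\xi^k)=\mathrm{col}\{\nabla F_i(x_i^k;\xi_i^k)\}$,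 $\nabla\mathbf f(\mathbf x)=\mathrm{col}\{\nabla f_i(x_i)\}$ in $\mathbb{R}^{Nd}$; $\mathbf x^\star=\mathbf 1\otimes x^\star$; $\mathbf\Pi=\Pi\otimes I_d$; $\widetilde{\mathbf W}_k=\widetilde W_k\otimes I_d$; $\bar x^k=\frac1N\sum_i x_i^k$; $\widehat{\mathbf x}^k=(\mathbf I-\mathbf\Pi)\mathbf x^k$; $\mathbf y^k=\mathbf g^k-\nabla\mathbf F(\mathbf x^k;\boldsymbol\xi^k)$; $\widetilde{\mathbf y}^k=\mathbf y^k+\nabla\mathbf f(\mathbf x^\star)$; $\eta=\frac{\Delta_\lambda}{2\tau}$; $\mathbf z^k=\frac{\alpha}{\eta}\widetilde{\mathbf y}^k$; $\delta=\frac{1-\lambda^2}{\tau}$; $Q=1+\frac{8}{\eta^2}=1+\frac{32\tau^2}{\Delta_\lambda^2}$. Let $\mathbf R_k=\delta\sum_{r=0}^\infty\mathbf\Psi(k+r,k)^{\mathsf T}\mathbf\Psi(k+r,k)$ with $\mathbf\Psi(t,s)=\widetilde{\mathbf W}_{t-1}\cdots\widetilde{\mathbf W}_s$ for $t>s$, $\mathbf\Psi(s,s)=\mathbf I$ (the series converges under the network assumption), and $\|\mathbf q\|_{\mathbf R}^2=\mathbf q^{\mathsf T}\mathbf R\mathbf q$. Define $$\widetilde X_k=\mathbb{E}\|\bar x^k-x^\star\|^2,\qquad E_k=\tfrac1N\mathbb{E}\bigl[\|\widehat{\mathbf x}^k\|_{\mathbf R_k}^2+2\|\mathbf z^k\|_{\mathbf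 R_k}^2\bigr].$$ *)

(* Defs.v *)
(* MathComp / MathComp-Analysis. *)
From HB Require Import structures.
From mathcomp Require Export all_boot all_order all_algebra.
From mathcomp Require Export all_classical all_reals all_analysis.

Set Implicit Arguments.
Unset Strict Implicit.
Unset Printing Implicit Defensive.

Export Order.TTheory GRing.Theory Num.Theory.
Export numFieldNormedType.Exports.

Local Open Scope classical_set_scope.
Local Open Scope ring_scope.

(* A stacked vector col{x_1, ..., x_N} of R^(N d) is the matrix X : 'M[R]_(N, d)
   whose i-th row is x_i.  Under this identification (A (x) I_d) x is A *m X,
   the Euclidean norm on R^(N d) is the Frobenius norm of X, and the quadratic
   form of A (x) I_d is the trace of X^T A X. *)

Section Euclidean.
Variable R : realType.

(* The library norm on 'M[R]_(m, n) is the sup norm, hence these. *)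
Definition sqnorm m n (A : 'M[R]_(m, n)) : R := \sum_i \sum_j A i j ^+ 2.
Definition l2norm m n (A : 'M[R]_(m, n)) : R := Num.sqrt (sqnorm A).

Definition opnorm2 m n (A : 'M[R]_(m, n)) : R :=
  sup [set l2norm (A *m v) | v in [set v : 'cV[R]_n | l2norm v <= 1]].

Definition qform N d (A : 'M[R]_N) (X : 'M[R]_(N, d)) : R :=
  \tr (X^T *m A *m X).

Definition grad d (f : 'rV[R]_d -> R) (x : 'rV[R]_d) : 'rV[R]_d :=
  \row_j 'D_(delta_mx 0 j) f x.

Definition smooth d (L : R) (f : 'rV[R]_d -> R) : Prop :=
  forall x y, l2norm (grad f x - grad f y) <= L * l2norm (x - y).

End Euclidean.

Section ConditionalExpectation.
Context {R : realType} {dO : measure_display} {Omega : measurableType dO}.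
Variables (P : probability Omega R) (G : set (set Omega)).

(* [G] is meant to be a sub-sigma-algebra of [measurable]. *)
Definition sub_measurable (X : Omega -> R) : Prop :=
  forall B, measurable B -> G (X @^-1` B).

(* [Y] is a version of the conditional expectation E[X | G]. *)
Definition is_cond_exp (X Y : Omega -> R) : Prop :=
  [/\ P.-integrable setT (EFin \o X), P.-integrable setT (EFin \o Y),
      sub_measurable Y &
      forall A, G A ->
        (\int[P]_(w in A) (X w)%:E)%E = (\int[P]_(w in A) (Y w)%:E)%E].

(* For all measurable A_i,
     P(X_i \in A_i for all i | G) = \prod_i P(X_i \in A_i | G)   a.s.;
   the choice A_i = setT gives the product rule for subfamilies. *)
Definition cond_independent (I : finType) (dX : measure_display)
    (S : I -> measurableType dX) (X : forall i, Omega -> S i) : Prop :=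
  forall A : (forall i, set (S i)), (forall i, measurable (A i)) ->
  exists p : I -> Omega -> R,
    (forall i, is_cond_exp \1_(X i @^-1` A i) (p i)) /\
    is_cond_exp \1_(\bigcap_i (X i @^-1` A i)) (fun w => \prod_i p i w).

End ConditionalExpectation.

Section Network.
Variables (R : realType) (N : nat).

Definition avg_mx : 'M[R]_N := const_mx N%:R^-1.

Definition doubly_stochastic (A : 'M[R]_N) : Prop :=
  [/\ forall i j, 0 <= A i j,
      A *m const_mx 1 = const_mx 1 :> 'cV[R]_N &
      const_mx 1 *m A = const_mx 1 :> 'rV[R]_N].

Variable W : nat -> 'M[R]_N.

(* Psi s r is Psi(s + r, s) = Wt_(s+r-1) ... Wt_s, where Wt_k = W_k - Pi. *)
Fixpoint Psi (s r : nat) : 'M[R]_N :=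
  if r is r'.+1 then (W (s + r')%N - avg_mx) *m Psi s r' else 1%:M.

Definition network_assumption (tau : nat) (lam : R) : Prop :=
  (forall k, doubly_stochastic (W k)) /\
  (forall k, opnorm2 (Psi k tau) <= lam).

Definition eta_cst (tau : nat) (lam : R) : R := (1 - lam) / (2 * tau%:R).
Definition delta_cst (tau : nat) (lam : R) : R := (1 - lam ^+ 2) / tau%:R.
Definition Q_cst (tau : nat) (lam : R) : R := 1 + 8 / eta_cst tau lam ^+ 2.

(* The N x N factor of R_k, which is (lyap_mx k) (x) I_d; the limit is taken in
   the topology of matrices. *)
Definition lyap_mx (tau : nat) (lam : R) (k : nat) : 'M[R]_N :=
  delta_cst tau lam *: limn (series (fun r => (Psi k r)^T *m Psi k r)).

End Network.

Section Algorithm.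
Variables (R : realType) (N d : nat) (dX : measure_display).
Variable Xi : 'I_N -> measurableType dX.
Variable F : forall i, 'rV[R]_d -> Xi i -> R.
Variable f : 'I_N -> 'rV[R]_d -> R.
Variables (W : nat -> 'M[R]_N) (alpha : R) (x0 : 'M[R]_(N, d)).

Definition stoch_grad (x : 'M[R]_(N, d)) (s : forall i, Xi i) : 'M[R]_(N, d) :=
  \matrix_(i < N) grad (fun u => F u (s i)) (row i x).

Definition full_grad (x : 'M[R]_(N, d)) : 'M[R]_(N, d) :=
  \matrix_(i < N) grad (f i) (row i x).

Definition favg (x : 'rV[R]_d) : R := N%:R^-1 * \sum_i f i x.

(* The pair (x^k, g^k) along the sample path [s], where [s k i] is the sample
   drawn by agent i at iteration k. *)
Fixpoint sgt (s : nat -> forall i, Xi i) (k : nat) :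
    'M[R]_(N, d) * 'M[R]_(N, d) :=
  if k is k'.+1 then
    let: (x, g) := sgt s k' in
    let x' := W k' *m (x - alpha *: g) in
    (x', W k' *m g + stoch_grad x' (s k) - stoch_grad x (s k'))
  else (x0, stoch_grad x0 (s 0%N)).

Definition rowavg (x : 'M[R]_(N, d)) : 'rV[R]_d := N%:R^-1 *: \sum_i row i x.

Definition centered (x : 'M[R]_(N, d)) : 'M[R]_(N, d) :=
  (1%:M - avg_mx R N) *m x.

Context {dO : measure_display} {Omega : measurableType dO}.
Variable P : probability Omega R.
Variable xi : nat -> forall i, {mfun Omega >-> Xi i}.

Definition samples (w : Omega) (k : nat) (i : 'I_N) : Xi i := xi k i w.

Definition xit (k : nat) (w : Omega) : 'M[R]_(N, d) := (sgt (samples w) k).1.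
Definition git (k : nat) (w : Omega) : 'M[R]_(N, d) := (sgt (samples w) k).2.

Definition grad_noise (k : nat) (i : 'I_N) (w : Omega) : 'rV[R]_d :=
  row i (stoch_grad (xit k w) (samples w k) - full_grad (xit k w)).

(* [Fk k] is the information available immediately before the samples of
   iteration k are drawn. *)
Record noise_assumption (Fk : nat -> set (set Omega)) (sigma : R) : Prop := {
  info_sigma_algebra : forall k, sigma_algebra setT (Fk k) ;
  info_measurable : forall k, Fk k `<=` measurable ;
  info_iterates : forall k l i j, (l < k)%N ->
    sub_measurable (Fk k) (fun w => xit l w i j) /\
    sub_measurable (Fk k) (fun w => git l w i j) ;
  info_samples : forall k l i (A : set (Xi i)), (l < k)%N ->
    measurable A -> Fk k (xi l i @^-1` A) ;
  samples_independent : forall k,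
    cond_independent P (Fk k) (fun i => xi k i : Omega -> Xi i) ;
  noise_unbiased : forall k i j,
    is_cond_exp P (Fk k) (fun w => grad_noise k i w 0 j) (cst 0) ;
  noise_variance : forall k i, exists v : Omega -> R,
    is_cond_exp P (Fk k) (fun w => sqnorm (grad_noise k i w)) v /\
    {ae P, forall w, v w <= sigma ^+ 2} }.

Variables (tau : nat) (lam : R) (xstar : 'rV[R]_d).

Definition ytilde (k : nat) (w : Omega) : 'M[R]_(N, d) :=
  git k w - stoch_grad (xit k w) (samples w k) + full_grad (\matrix_(i < N) xstar).

Definition zit (k : nat) (w : Omega) : 'M[R]_(N, d) :=
  (alpha / eta_cst tau lam) *: ytilde k w.

Definition Xtilde (k : nat) : \bar R :=
  'E_P[fun w => sqnorm (rowavg (xit k w) - xstar)].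

Definition Elyap (k : nat) : \bar R :=
  (N%:R^-1%:E *
   'E_P[fun w => (qform (lyap_mx W tau lam k) (centered (xit k w)) +
                  2 * qform (lyap_mx W tau lam k) (zit k w))%R])%E.

End Algorithm.

(* Main.v *)
Require Import Defs.
From mathcomp Require Import all_boot all_order all_algebra.
From mathcomp Require Import all_classical all_reals all_analysis.
From mathcomp Require Import measurable_realfun.
From mathcomp Require Import ring lra.

(** Two quantities are followed along the iteration: the distance of the
    average iterate to [xstar], and a Lyapunov function of the disagreement
    [centered x] and of the scaled tracking error [z], measured by the
    quadratic forms [lyap_mx].

    The average iterate performs a gradient step of [favg] with the gradients
    taken at the wrong points, plus the averaged noise.  Convexity and
    smoothness turn this into a decrease proportional to the optimality gap, up
    to a multiple of the disagreement ([avg_step_drift]).  The noises of the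
    agents being conditionally independent and centered, they are orthogonal,
    and averaging divides their variance by [N] ([Ex_sqnorm_rowavg_le]).

    The disagreement and the tracking error are both multiplied by [W k - Pi] at
    each step.  A product of [tau] such matrices contracts, but a single one need
    not; the series defining [lyap_mx] is built so that one factor lowers the
    form by exactly [delta * sqnorm] ([qform_lyapS]), while the form stays below
    [sqnorm] ([qform_lyap_le]).  Young's inequality spends half of this decrease
    on the other terms ([lyap_step_drift]): the tracking error and the deviation
    of the gradients from their values at [xstar].  By cocoercivity this last
    deviation is bounded by the disagreement and the optimality gap
    ([full_grad_diff_le]).

    Each recursion thus has an error term controlled by the decrease in the
    other one, and for the stepsizes of the theorem a positive combination of
    the two absorbs both error terms ([combine_recursions]); the sum over the
    iterations then telescopes.

    The probabilistic content is a single principle, [orthogonal_measurable]: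
    a variable with zero integral over every event described by a random
    element [phi] is orthogonal to every square integrable function of [phi].
    With [phi] the past it removes the cross terms between iterates and noise;
    with [phi] the past and the sample of one agent it yields the orthogonality
    of the noises of two agents ([cond_independent_orthogonal]).  Applying it
    requires the stochastic gradients to be jointly measurable in the point and
    the sample, which holds because they are limits of difference quotients of
    functions continuous in the point ([measurable_grad]). *)

Set Implicit Arguments.
Unset Strict Implicit.
Unset Printing Implicit Defensive.

Local Open Scope classical_set_scope.
Local Open Scope ring_scope.

(** * Frobenius product and quadratic forms *)

Section FrobeniusProduct.
Variable R : realType.
Implicit Types m n : nat.

Definition dot m n (A B : 'M[R]_(m, n)) : R := \tr (A^T *m B).

Lemma dotE m n (A B : 'M[R]_(m, n)) : dot A B = \sum_i \sum_j A i j * B i j.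
Proof.
rewrite /dot /mxtrace exchange_big; apply: eq_bigr => j _ /=.
by rewrite mxE; apply: eq_bigr => i _; rewrite !mxE.
Qed.

Lemma dotC m n (A B : 'M[R]_(m, n)) : dot A B = dot B A.
Proof. by rewrite /dot -mxtrace_tr trmx_mul trmxK. Qed.

Lemma dotDr m n (A B C : 'M[R]_(m, n)) : dot A (B + C) = dot A B + dot A C.
Proof. by rewrite /dot mulmxDr mxtraceD. Qed.

Lemma dotDl m n (A B C : 'M[R]_(m, n)) : dot (A + B) C = dot A C + dot B C.
Proof. by rewrite dotC dotDr !(dotC C). Qed.

Lemma dotZr m n a (A B : 'M[R]_(m, n)) : dot A (a *: B) = a * dot A B.
Proof. by rewrite /dot -scalemxAr mxtraceZ. Qed.

Lemma dotZl m n a (A B : 'M[R]_(m, n)) : dot (a *: A) B = a * dot A B.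
Proof. by rewrite dotC dotZr dotC. Qed.

Lemma dotNr m n (A B : 'M[R]_(m, n)) : dot A (- B) = - dot A B.
Proof. by rewrite -scaleN1r dotZr mulN1r. Qed.

Lemma dotNl m n (A B : 'M[R]_(m, n)) : dot (- A) B = - dot A B.
Proof. by rewrite dotC dotNr dotC. Qed.

Lemma dot0r m n (A : 'M[R]_(m, n)) : dot A 0 = 0.
Proof. by rewrite /dot mulmx0 mxtrace0. Qed.

Lemma dot0l m n (A : 'M[R]_(m, n)) : dot 0 A = 0.
Proof. by rewrite dotC dot0r. Qed.

Lemma dot_mulmx m n p (A : 'M[R]_(m, n)) (X : 'M[R]_(n, p)) Y :
  dot (A *m X) Y = dot X (A^T *m Y).
Proof. by rewrite /dot trmx_mul mulmxA. Qed.

Lemma dot_suml m n I (r : seq I) (P : pred I) (A : I -> 'M[R]_(m, n)) B :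
  dot (\sum_(i <- r | P i) A i) B = \sum_(i <- r | P i) dot (A i) B.
Proof.
elim/big_rec2: _ => [|i y1 y2 _ <-]; first by rewrite dot0l.
by rewrite dotDl.
Qed.

Lemma dot_sumr m n I (r : seq I) (P : pred I) (A : I -> 'M[R]_(m, n)) B :
  dot B (\sum_(i <- r | P i) A i) = \sum_(i <- r | P i) dot B (A i).
Proof. by rewrite dotC dot_suml; apply: eq_bigr => i _; rewrite dotC. Qed.

Definition dot_lin := (dotDl, dotDr, dotNl, dotNr, dotZl, dotZr).

Lemma sqnorm_dot m n (A : 'M[R]_(m, n)) : sqnorm A = dot A A.
Proof. by rewrite dotE; do 2!(apply: eq_bigr => ? _); rewrite expr2. Qed.

Lemma sqnorm_ge0 m n (A : 'M[R]_(m, n)) : 0 <= sqnorm A.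
Proof. by apply: sumr_ge0 => i _; apply: sumr_ge0 => j _; rewrite sqr_ge0. Qed.

Lemma sqnorm0 m n : sqnorm (0 : 'M[R]_(m, n)) = 0.
Proof. by rewrite sqnorm_dot dot0r. Qed.

Lemma sqnorm_eq0 m n (A : 'M[R]_(m, n)) : sqnorm A = 0 -> A = 0.
Proof.
move=> A0; apply/matrixP => i j; rewrite mxE; apply/eqP.
have Ai_ge0 k : 0 <= \sum_j A k j ^+ 2.
  by apply: sumr_ge0 => l _; rewrite sqr_ge0.
have Ai0 : \sum_j A i j ^+ 2 = 0 by apply: (psumr_eq0P _ A0).
suff : A i j ^+ 2 = 0 by move/eqP; rewrite sqrf_eq0.
by apply: (psumr_eq0P _ Ai0) => // l _; rewrite sqr_ge0.
Qed.

Lemma sqnormZ m n a (A : 'M[R]_(m, n)) : sqnorm (a *: A) = a ^+ 2 * sqnorm A.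
Proof. by rewrite !sqnorm_dot !dot_lin mulrA. Qed.

Lemma sqnormN m n (A : 'M[R]_(m, n)) : sqnorm (- A) = sqnorm A.
Proof. by rewrite -scaleN1r sqnormZ sqrrN expr1n mul1r. Qed.

Lemma sqnormD m n (A B : 'M[R]_(m, n)) :
  sqnorm (A + B) = sqnorm A + 2 * dot A B + sqnorm B.
Proof. by rewrite !sqnorm_dot !dot_lin (dotC B A); ring. Qed.

Lemma sqnormB m n (A B : 'M[R]_(m, n)) :
  sqnorm (A - B) = sqnorm A - 2 * dot A B + sqnorm B.
Proof. by rewrite !sqnorm_dot !dot_lin (dotC B A); ring. Qed.

Lemma sqnormD_le m n (A B : 'M[R]_(m, n)) :
  sqnorm (A + B) <= 2 * sqnorm A + 2 * sqnorm B.
Proof.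
have := sqnorm_ge0 (A - B); rewrite sqnormB (sqnormD A B); lra.
Qed.

Lemma sqnormB_le m n (A B : 'M[R]_(m, n)) :
  sqnorm (A - B) <= 2 * sqnorm A + 2 * sqnorm B.
Proof.
have := sqnorm_ge0 (A + B); rewrite sqnormB (sqnormD A B); lra.
Qed.

Lemma cauchy_schwarz m n (A B : 'M[R]_(m, n)) :
  dot A B ^+ 2 <= sqnorm A * sqnorm B.
Proof.
have [B0|/eqP Bn0] := eqVneq (sqnorm B) 0.
  by rewrite B0 (sqnorm_eq0 B0) dot0r expr0n mulr0.
have Bgt0 : 0 < sqnorm B by rewrite lt_neqAle sqnorm_ge0 andbT eq_sym; apply/eqP.
have := sqnorm_ge0 (sqnorm B *: A - dot A B *: B).
rewrite sqnormB !sqnormZ !dot_lin => h.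
have {h} : 0 <= sqnorm B * (sqnorm A * sqnorm B - dot A B ^+ 2).
  by apply: le_trans h _; rewrite le_eqVlt; apply/orP; left; apply/eqP; ring.
by rewrite pmulr_rge0// subr_ge0.
Qed.

Lemma l2norm_le_sqr m n p q (A : 'M[R]_(m, n)) (B : 'M[R]_(p, q)) (c : R) :
  0 <= c -> l2norm A <= c * l2norm B -> sqnorm A <= c ^+ 2 * sqnorm B.
Proof.
move=> c0 AB.
have := lerXn2r 2 _ _ AB; rewrite !nnegrE sqrtr_ge0.
rewrite mulr_ge0 ?sqrtr_ge0// => /(_ isT isT).
by rewrite exprMn !sqr_sqrtr ?sqnorm_ge0.
Qed.

Lemma sqnorm_rows m n (A : 'M[R]_(m, n)) : sqnorm A = \sum_i sqnorm (row i A).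
Proof.
rewrite /sqnorm; apply: eq_bigr => i _; rewrite big_ord1.
by apply: eq_bigr => j _; rewrite mxE.
Qed.

Lemma sqnorm_cols m n (A : 'M[R]_(m, n)) : sqnorm A = \sum_j sqnorm (col j A).
Proof.
rewrite /sqnorm exchange_big; apply: eq_bigr => i _ /=.
by apply: eq_bigr => j _; rewrite big_ord1 mxE.
Qed.

Lemma sqnorm_mulmx_le m n p (A : 'M[R]_(m, n)) (B : 'M[R]_(n, p)) :
  sqnorm (A *m B) <= sqnorm A * sqnorm B.
Proof.
rewrite (sqnorm_rows A) (sqnorm_cols B) mulr_suml.
apply: ler_sum => i _; rewrite mulr_sumr; apply: ler_sum => j _.
have -> : (A *m B) i j = dot (row i A)^T (col j B).
  rewrite dotE mxE; apply: eq_bigr => k _; rewrite big_ord1 !mxE.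
  by [].
apply: le_trans (cauchy_schwarz _ _) _.
have -> : sqnorm (row i A)^T = sqnorm (row i A).
  by rewrite /sqnorm exchange_big; do 2!(apply: eq_bigr => ? _); rewrite !mxE.
by [].
Qed.

(** The supremum in [opnorm2] is over a bounded set by [sqnorm_mulmx_le], and
    it extends from vectors to matrices because [sqnorm] is additive over the
    columns. *)
Lemma opnorm2_le m n p (A : 'M[R]_(m, n)) (X : 'M[R]_(n, p)) (c : R) :
  0 <= c -> opnorm2 A <= c -> sqnorm (A *m X) <= c ^+ 2 * sqnorm X.
Proof.
move=> c0 Ac.
have colP (v : 'cV[R]_n) : sqnorm (A *m v) <= c ^+ 2 * sqnorm v.
  have [v0|/eqP vn0] := eqVneq (sqnorm v) 0.
    by rewrite v0 (sqnorm_eq0 v0) mulmx0 sqnorm0 mulr0.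
  have vgt0 : 0 < sqnorm v by rewrite lt_neqAle sqnorm_ge0 andbT eq_sym; apply/eqP.
  set s := l2norm v; have sgt0 : 0 < s by rewrite sqrtr_gt0.
  have us : l2norm (s^-1 *: v) <= 1.
    rewrite /l2norm sqnormZ exprVn sqr_sqrtr ?sqnorm_ge0// mulVf ?gt_eqF//.
    by rewrite sqrtr1.
  have ubA : has_ubound [set l2norm (A *m v) | v in [set v : 'cV[R]_n | l2norm v <= 1]].
    exists (Num.sqrt (sqnorm A)) => _ [u /= u1 <-].
    rewrite ler_sqrt ?sqnorm_ge0//.
    apply: le_trans (sqnorm_mulmx_le _ _) _.
    rewrite ler_piMr ?sqnorm_ge0//.
    by move: u1; rewrite /l2norm -[leRHS]sqrtr1 ler_sqrt.
  have : l2norm (A *m (s^-1 *: v)) <= c.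
    apply: le_trans Ac; apply: (@sup_upper_bound _ [set l2norm (A *m v) | v in [set v : 'cV[R]_n | l2norm v <= 1]]); last by exists (s^-1 *: v).
    by split => //; exists (l2norm (A *m (s^-1 *: v))), (s^-1 *: v).
  rewrite -scalemxAr => h.
  have : l2norm (s^-1 *: (A *m v)) <= c * l2norm (const_mx 1 : 'M[R]_1).
    rewrite [X in c * X](_ : _ = 1) ?mulr1//.
    by rewrite /l2norm /sqnorm !big_ord1 mxE expr1n sqrtr1.
  move/(l2norm_le_sqr c0); rewrite sqnormZ.
  rewrite /(sqnorm (const_mx _)) !big_ord1 mxE expr1n mulr1.
  by rewrite exprVn sqr_sqrtr ?sqnorm_ge0// mulrC ler_pdivrMr.
rewrite (sqnorm_cols (A *m X)) (sqnorm_cols X) mulr_sumr.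
by apply: ler_sum => j _; rewrite !colE -mulmxA colP.
Qed.

Lemma qform_dot n d (A : 'M[R]_n) (X : 'M[R]_(n, d)) : qform A X = dot X (A *m X).
Proof. by rewrite /qform /dot mulmxA. Qed.

Lemma qformD n d (A : 'M[R]_n) (X Y : 'M[R]_(n, d)) :
  qform A (X + Y) = qform A X + (dot X (A *m Y) + dot Y (A *m X)) + qform A Y.
Proof. by rewrite !qform_dot mulmxDr !dot_lin; ring. Qed.

Lemma qformZ n d (A : 'M[R]_n) a (X : 'M[R]_(n, d)) :
  qform A (a *: X) = a ^+ 2 * qform A X.
Proof. by rewrite !qform_dot -scalemxAr !dot_lin; ring. Qed.

(** Expand the nonnegative value of the form at [b *: X - Y] and divide by [b]. *)
Lemma qformD_young n d (A : 'M[R]_n) (b : R) (X Y : 'M[R]_(n, d)) :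
  (forall Z : 'M[R]_(n, d), 0 <= qform A Z) -> 0 < b ->
  qform A (X + Y) <= (1 + b) * qform A X + (1 + b^-1) * qform A Y.
Proof.
move=> A0 b0; have h := A0 (b *: X + (-1) *: Y).
rewrite qformD !qformZ -!scalemxAr !dot_lin sqrrN expr1n mul1r in h.
rewrite qformD.
set x := qform A X in h *; set y := qform A Y in h *.
set c := dot X _ + _ in h *.
have bc : b * c <= b ^+ 2 * x + y.
  by rewrite -subr_ge0; apply: le_trans h _; rewrite /c le_eqVlt; apply/orP; left; apply/eqP; ring.
have -> : (1 + b) * x + (1 + b^-1) * y = x + b^-1 * (b ^+ 2 * x + y) + y.
  by field; rewrite gt_eqF.
rewrite lerD2r lerD2l -[leLHS]mul1r -[1](@mulVf _ b) ?gt_eqF// -mulrA.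
by rewrite ler_pM2l ?invr_gt0.
Qed.

End FrobeniusProduct.

(** * Limits of matrices *)

Section MatrixLimits.
Variable R : realType.

Lemma cvg_mx_entries m n (u : nat -> 'M[R]_(m, n)) (M : 'M[R]_(m, n)) :
  (forall i j, u k i j @[k --> \oo] --> M i j) -> u k @[k --> \oo] --> M.
Proof.
move=> uM; apply/cvg_mx_entourageP => A entA.
have FF : Filter (u k @[k --> \oo]) by exact: fmap_filter.
apply: (@filter_forall _ _ (fun i => [set B : 'M[R]_(m, n) | forall j, (M i j, B i j) \in A])) => i.
apply: (@filter_forall _ _ (fun j => [set B : 'M[R]_(m, n) | (M i j, B i j) \in A])) => j.
have /cvg_app_entourageP /(_ A entA) := uM i j.
by apply: filterS => k /=; rewrite inE.
Qed.

Lemma cvgn_sum (I : Type) (r : seq I) (u : I -> nat -> R) (l : I -> R) :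
  (forall i, u i k @[k --> \oo] --> l i) ->
  \sum_(i <- r) u i k @[k --> \oo] --> \sum_(i <- r) l i.
Proof.
move=> ul; elim: r => [|i r IHr].
  rewrite big_nil; under eq_fun do rewrite big_nil.
  exact: cvg_cst.
rewrite big_cons; under eq_fun do rewrite big_cons.
exact: cvgD (ul i) IHr.
Qed.

Lemma cvg_qform N d (u : nat -> 'M[R]_N) (M : 'M[R]_N) (X : 'M[R]_(N, d)) :
  (forall i j, u k i j @[k --> \oo] --> M i j) ->
  qform (u k) X @[k --> \oo] --> qform M X.
Proof.
move=> uM.
rewrite (_ : (fun k => _) =
    fun k => \sum_i \sum_j X i j * \sum_l u k i l * X l j); last first.
  apply/funext => k; rewrite qform_dot dotE.
  by apply: eq_bigr => i _; apply: eq_bigr => j _; rewrite mxE.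
rewrite (_ : qform M X = \sum_i \sum_j X i j * \sum_l M i l * X l j); last first.
  rewrite qform_dot dotE.
  by apply: eq_bigr => i _; apply: eq_bigr => j _; rewrite mxE.
apply: cvgn_sum => i; apply: cvgn_sum => j; apply: cvgMl_tmp.
by apply: cvgn_sum => l; apply: cvgMr_tmp; exact: uM.
Qed.

End MatrixLimits.

(** * Products of mixing matrices and the Lyapunov forms *)

Section Network.
Variables (R : realType) (N : nat) (W : nat -> 'M[R]_N) (tau : nat) (lam : R).
Hypothesis N_gt0 : (0 < N)%N.
Hypotheses (tau_gt0 : (0 < tau)%N) (lam_ge0 : 0 <= lam) (lam_lt1 : lam < 1).
Hypothesis W_network : network_assumption W tau lam.

Local Notation Pi := (avg_mx R N).
Local Notation Wt k := (W k - Pi).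

Lemma doubly_stochastic_rowsum (A : 'M[R]_N) i :
  doubly_stochastic A -> \sum_j A i j = 1.
Proof.
case=> _ /matrixP /(_ i 0) + _; rewrite !mxE => <-.
by apply: eq_bigr => j _; rewrite mxE mulr1.
Qed.

Lemma doubly_stochastic_colsum (A : 'M[R]_N) j :
  doubly_stochastic A -> \sum_i A i j = 1.
Proof.
case=> _ _ /matrixP /(_ 0 j); rewrite !mxE => <-.
by apply: eq_bigr => i _; rewrite mxE mul1r.
Qed.

Lemma mul_doubly_stochastic_avg (A : 'M[R]_N) : doubly_stochastic A -> A *m Pi = Pi.
Proof.
move=> dA; apply/matrixP => i j; rewrite !mxE.
under eq_bigr do rewrite mxE.
by rewrite -mulr_suml doubly_stochastic_rowsum// mul1r.
Qed.

Lemma mul_avg_doubly_stochastic (A : 'M[R]_N) : doubly_stochastic A -> Pi *m A = Pi.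
Proof.
move=> dA; apply/matrixP => i j; rewrite !mxE.
under eq_bigr do rewrite mxE.
by rewrite -mulr_sumr doubly_stochastic_colsum// mulr1.
Qed.

Lemma avg_mx_idem : Pi *m Pi = Pi.
Proof.
apply/matrixP => i j; rewrite !mxE; under eq_bigr do rewrite !mxE.
rewrite sumr_const card_ord -[X in X = _]mulr_natr -mulrA mulVf ?mulr1//.
by rewrite pnatr_eq0 -lt0n.
Qed.

Lemma avg_mx_tr : Pi^T = Pi.
Proof. by apply/matrixP => i j; rewrite !mxE. Qed.

(** Centering is an orthogonal projection. *)
Lemma sqnorm_centered_le d (X : 'M[R]_(N, d)) : sqnorm (centered X) <= sqnorm X.
Proof.
rewrite /centered mulmxBl mul1mx sqnormB.
have -> : dot X (Pi *m X) = sqnorm (Pi *m X).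
  by rewrite sqnorm_dot dot_mulmx avg_mx_tr mulmxA avg_mx_idem.
have := sqnorm_ge0 (Pi *m X); lra.
Qed.

(** Jensen's inequality along each row of [A], then the column sums. *)
Lemma doubly_stochastic_contract d (A : 'M[R]_N) (X : 'M[R]_(N, d)) :
  doubly_stochastic A -> sqnorm (A *m X) <= sqnorm X.
Proof.
move=> dA; have [A0 _ _] := dA.
have jensen i j : (A *m X) i j ^+ 2 <= \sum_k A i k * X k j ^+ 2.
  set m := (A *m X) i j.
  have : 0 <= \sum_k A i k * (X k j - m) ^+ 2.
    by apply: sumr_ge0 => k _; rewrite mulr_ge0 ?sqr_ge0.
  have -> : \sum_k A i k * (X k j - m) ^+ 2 = \sum_k A i k * X k j ^+ 2
      - 2 * m * (\sum_k A i k * X k j) + (\sum_k A i k) * m ^+ 2.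
    rewrite mulr_sumr mulr_suml -sumrB -big_split/=.
    by apply: eq_bigr => k _; ring.
  have -> : \sum_k A i k * X k j = m by rewrite /m mxE.
  by rewrite doubly_stochastic_rowsum//; lra.
apply: (@le_trans _ _ (\sum_i \sum_j \sum_k A i k * X k j ^+ 2)).
  by apply: ler_sum => i _; apply: ler_sum => j _; exact: jensen.
under eq_bigr do rewrite exchange_big.
rewrite exchange_big/=; apply: ler_sum => k _.
rewrite exchange_big/=; apply: ler_sum => j _.
by rewrite -mulr_suml doubly_stochastic_colsum// mul1r.
Qed.

Lemma Wt_centered k d (X : 'M[R]_(N, d)) : Wt k *m X = W k *m centered X.
Proof.
have [dW _] := W_network.
by rewrite /centered mulmxA mulmxBr mulmx1 mul_doubly_stochastic_avg.
Qed.

Lemma Wt_contract k d (X : 'M[R]_(N, d)) : sqnorm (Wt k *m X) <= sqnorm X.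
Proof.
have [dW _] := W_network; rewrite Wt_centered.
exact: le_trans (doubly_stochastic_contract _ (dW k)) (sqnorm_centered_le _).
Qed.

Lemma Psi_addn s q r : Psi W s (q + r) = Psi W (s + q) r *m Psi W s q.
Proof.
elim: r => [|r IHr]; first by rewrite addn0 mul1mx.
by rewrite addnS /= IHr mulmxA addnA.
Qed.

Lemma Psi_contract s r d (X : 'M[R]_(N, d)) : sqnorm (Psi W s r *m X) <= sqnorm X.
Proof.
elim: r => [|r IHr]; first by rewrite mul1mx.
by rewrite /= -mulmxA (le_trans (Wt_contract _ _)).
Qed.

Local Notation delta := (delta_cst tau lam).

Lemma delta_gt0 : 0 < delta.
Proof. by rewrite divr_gt0 ?ltr0n// subr_gt0 expr_lt1. Qed.

Lemma delta_le1 : delta <= 1.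
Proof.
rewrite ler_pdivrMr ?ltr0n// mul1r.
apply: (@le_trans _ _ 1); last by rewrite ler1n.
by rewrite lerBlDr lerDl sqr_ge0.
Qed.

(** The bound reproduces itself block by block: [tau] terms of the sum cost at
    most [(1 - lam ^+ 2) * sqnorm X] after multiplication by [delta], since no
    product increases the norm, and the remaining terms form the same sum
    started from a vector of square norm at most [lam ^+ 2 * sqnorm X]. *)
Lemma sum_Psi_le n k d (X : 'M[R]_(N, d)) :
  delta * \sum_(r < n) sqnorm (Psi W k r *m X) <= sqnorm X.
Proof.
suff main m : forall k (X : 'M[R]_(N, d)),
    delta * \sum_(r < m * tau) sqnorm (Psi W k r *m X) <= sqnorm X.
  apply: le_trans (main n k X); rewrite ler_pM2l ?delta_gt0//.
  rewrite -!(big_mkord xpredT (fun r => sqnorm (Psi W k r *m X))).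
  rewrite (@big_cat_nat _ _ _ n 0 (n * tau))//= ?leq_pmulr// lerDl.
  by apply: sumr_ge0 => i _; rewrite sqnorm_ge0.
elim: m => [|m IHm] {}k {}X; first by rewrite big_ord0 mulr0 sqnorm_ge0.
rewrite mulSn big_split_ord/= mulrDr.
have -> : \sum_(i < m * tau) sqnorm (Psi W k (tau + i) *m X) =
          \sum_(i < m * tau) sqnorm (Psi W (k + tau) i *m (Psi W k tau *m X)).
  by apply: eq_bigr => i _; rewrite Psi_addn mulmxA.
have Ptau : sqnorm (Psi W k tau *m X) <= lam ^+ 2 * sqnorm X.
  by apply: opnorm2_le => //; have [_] := W_network; apply.
have first_block : delta * \sum_(i < tau) sqnorm (Psi W k i *m X) <=
    (1 - lam ^+ 2) * sqnorm X.
  rewrite /delta_cst -mulrA ler_wpM2l//; first by rewrite subr_ge0 expr_le1// ltW.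
  rewrite mulrC ler_pdivrMr ?ltr0n//.
  apply: (@le_trans _ _ (\sum_(i < tau) sqnorm X)).
    by apply: ler_sum => i _; exact: Psi_contract.
  by rewrite sumr_const card_ord mulr_natr.
have := IHm (k + tau)%N (Psi W k tau *m X); lra.
Qed.

Lemma is_cvg_sqnorm_Psi k d (X : 'M[R]_(N, d)) :
  cvgn (series (fun r => sqnorm (Psi W k r *m X))).
Proof.
apply: nondecreasing_is_cvgn.
  by apply: nondecreasing_series => n _ _; exact: sqnorm_ge0.
exists (sqnorm X / delta) => _ [n _ <-].
by rewrite ler_pdivlMr ?delta_gt0// mulrC seriesEord sum_Psi_le.
Qed.

(** By polarization, an entry of a Gram matrix is dominated by the sum of two
    diagonal ones. *)
Lemma is_cvg_gram_Psi k i j :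
  cvgn (series (fun r => ((Psi W k r)^T *m Psi W k r) i j)).
Proof.
pose e l : 'cV[R]_N := delta_mx l 0.
apply: normed_cvg.
apply: (@series_le_cvg _ _
  (fun r => sqnorm (Psi W k r *m e i) + sqnorm (Psi W k r *m e j))) => [n|n|n|].
- exact: normr_ge0.
- by rewrite addr_ge0 ?sqnorm_ge0.
- rewrite /=.
  have -> : ((Psi W k n)^T *m Psi W k n) i j =
      dot (Psi W k n *m e i) (Psi W k n *m e j).
    rewrite dot_mulmx mulmxA -colE dotE (bigD1 i)//= big_ord1.
    have -> : e i i 0 = 1 by rewrite mxE !eqxx.
    rewrite mul1r [X in _ = X + _]mxE [X in _ + X]big1 ?addr0 // => l li.
    have e0 : e i l 0 = 0 by rewrite mxE (negbTE li).
    by rewrite big_ord1 e0 mul0r.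
  set a := _ *m e i; set b := _ *m e j.
  have := sqnorm_ge0 (a - b); have := sqnorm_ge0 (a + b).
  rewrite sqnormB (sqnormD a b) ler_norml => h1 h2; apply/andP; split; lra.
- have -> : (fun r => sqnorm (Psi W k r *m e i) + sqnorm (Psi W k r *m e j)) =
     (fun r => sqnorm (Psi W k r *m e i)) + (fun r => sqnorm (Psi W k r *m e j)) by [].
  by apply: is_cvg_seriesD; exact: is_cvg_sqnorm_Psi.
Qed.

Local Notation gram k := (fun r => (Psi W k r)^T *m Psi W k r).

(** Identifies the limit taken in the topology of matrices, which a priori has
    an arbitrary value, with the entrywise limits. *)
Lemma cvg_gram_Psi k i j :
  series (gram k) n i j @[n --> \oo] --> (limn (series (gram k))) i j.
Proof.
pose M : 'M[R]_N := \matrix_(i, j) limn (series (fun r => gram k r i j)).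
have seriesM n i' j' : series (gram k) n i' j' = series (fun r => gram k r i' j') n.
  by rewrite /series /= summxE.
have entM i' j' : series (gram k) n i' j' @[n --> \oo] --> M i' j'.
  under eq_fun do rewrite seriesM.
  by rewrite mxE; exact: is_cvg_gram_Psi.
by rewrite (cvg_lim _ (cvg_mx_entries entM)).
Qed.

Lemma qform_lyap k d (X : 'M[R]_(N, d)) :
  qform (lyap_mx W tau lam k) X =
  delta * limn (series (fun r => sqnorm (Psi W k r *m X))).
Proof.
rewrite /lyap_mx qform_dot -scalemxAl dotZr -qform_dot; congr (_ * _).
symmetry; apply: cvg_lim => //.
have := @cvg_qform R N d _ _ X (@cvg_gram_Psi k).
rewrite (_ : (fun _ => qform _ _) = series (fun r => sqnorm (Psi W k r *m X)))//.
apply/funext => n; rewrite /series /= qform_dot mulmx_suml dot_sumr.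
by apply: eq_bigr => r _; rewrite sqnorm_dot dot_mulmx mulmxA.
Qed.

Lemma qform_lyap_le k d (X : 'M[R]_(N, d)) : qform (lyap_mx W tau lam k) X <= sqnorm X.
Proof.
rewrite qform_lyap mulrC -ler_pdivlMr ?delta_gt0//.
apply: limr_le; first exact: is_cvg_sqnorm_Psi.
apply: nearW => n.
by rewrite ler_pdivlMr ?delta_gt0// mulrC seriesEord sum_Psi_le.
Qed.

Lemma qform_lyap_ge0 k d (X : 'M[R]_(N, d)) : 0 <= qform (lyap_mx W tau lam k) X.
Proof.
rewrite qform_lyap mulr_ge0 ?(ltW delta_gt0)//.
apply: limr_ge; first exact: is_cvg_sqnorm_Psi.
by apply: nearW => n; apply: sumr_ge0 => r _; exact: sqnorm_ge0.
Qed.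

(** Applying [W k - Pi] shifts the series by one index, hence drops its first
    term.  This equality, rather than a contraction factor, is what makes the
    sum of the disagreements appear with the weight [delta]. *)
Lemma qform_lyapS k d (X : 'M[R]_(N, d)) :
  qform (lyap_mx W tau lam k.+1) (Wt k *m X) =
  qform (lyap_mx W tau lam k) X - delta * sqnorm X.
Proof.
rewrite !qform_lyap -mulrBr; congr (_ * _).
set u := fun r => sqnorm (Psi W k r *m X).
rewrite (_ : (fun r => _) = fun r => u r.+1); last first.
  apply/funext => r; rewrite /u mulmxA.
  have -> : Psi W k r.+1 = Psi W k.+1 r *m Wt k.
    by rewrite -[r.+1]add1n Psi_addn addn1 /= addn0 mulmx1.
  by [].
apply: cvg_lim => //.
have cu : series u n.+1 @[n --> \oo] --> limn (series u).
  by rewrite (cvg_shiftS (series u)); exact: is_cvg_sqnorm_Psi.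
have -> : sqnorm X = u 0%N by rewrite /u /= mul1mx.
have -> : series (fun r => u r.+1) = fun n => series u n.+1 - u 0%N.
  apply/funext => n; rewrite /series /= big_nat_recl//= addrAC subrr add0r.
  by [].
by apply: cvgB => //; exact: cvg_cst.
Qed.

End Network.

(** * One step of the Lyapunov forms *)

Section LyapunovStep.
Variables (R : realType) (N : nat) (W : nat -> 'M[R]_N) (tau : nat) (lam : R).
Hypothesis N_gt0 : (0 < N)%N.
Hypotheses (tau_gt0 : (0 < tau)%N) (lam_ge0 : 0 <= lam) (lam_lt1 : lam < 1).
Hypothesis W_network : network_assumption W tau lam.

Local Notation Pi := (avg_mx R N).
Local Notation Wt k := (W k - Pi).
Local Notation delta := (delta_cst tau lam).
Local Notation eta := (eta_cst tau lam).
Local Notation Q := (Q_cst tau lam).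
Local Notation q k := (qform (lyap_mx W tau lam k)).

Lemma eta_gt0 : 0 < eta.
Proof. by apply: divr_gt0; rewrite ?subr_gt0 ?mulr_gt0 ?ltr0n. Qed.

Lemma eta_le_delta : eta <= delta / 2.
Proof.
rewrite /eta_cst /delta_cst.
have -> : (1 - lam ^+ 2) / tau%:R / 2 = (1 - lam) * (1 + lam) / (2 * tau%:R).
  by field; rewrite pnatr_eq0 -lt0n.
rewrite ler_pM2r ?invr_gt0 ?mulr_gt0 ?ltr0n//.
by rewrite ler_peMr ?lerDl// subr_ge0 ltW.
Qed.

(** A crude size, from [eta <= 1 / 2]; it makes the stepsize small against
    [1 / L]. *)
Lemma Q_ge33 : 33 <= Q.
Proof.
have eta_gt := eta_gt0; have delta_le := delta_le1 lam tau_gt0.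
have eta_half : eta <= 2^-1 by have := eta_le_delta; lra.
have : 32 <= 8 / eta ^+ 2.
  by rewrite ler_pdivlMr ?exprn_gt0//; nra.
by rewrite /Q_cst; lra.
Qed.

Lemma sub1_W_le k d (X : 'M[R]_(N, d)) :
  q k.+1 ((1%:M - W k) *m X) <= 4 * sqnorm X.
Proof.
have [dW _] := W_network.
apply: le_trans (qform_lyap_le _ _ _ _ _ _ _) _ => //.
rewrite mulmxBl mul1mx; apply: le_trans (sqnormB_le _ _) _.
have := doubly_stochastic_contract X (dW k); lra.
Qed.

(** The origin of [Q]: the noise reaches the iterates with the factor [alpha]
    and the tracking error, which has weight 2, with the factor
    [(alpha / eta) * (1 - W k)], where [1 - W k] multiplies square norms by at
    most 4. *)
Lemma lyap_step_noise k d (n : 'M[R]_(N, d)) (alpha : R) :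
  q k.+1 (- alpha *: (Wt k *m n)) +
  2 * q k.+1 (- (alpha / eta) *: ((1%:M - W k) *m n)) <=
  alpha ^+ 2 * Q * sqnorm n.
Proof.
rewrite !qformZ !sqrrN expr_div_n.
have h1 : q k.+1 (Wt k *m n) <= sqnorm n.
  apply: le_trans (qform_lyap_le _ _ _ _ _ _ _) _ => //.
  exact: Wt_contract W_network _ _ _.
have h2 := sub1_W_le k n.
have eta2 : 0 < eta ^+ 2 by rewrite exprn_gt0 ?eta_gt0.
rewrite /Q_cst.
have -> : alpha ^+ 2 * (1 + 8 / eta ^+ 2) * sqnorm n =
  alpha ^+ 2 * sqnorm n + 2 * (alpha ^+ 2 / eta ^+ 2 * (4 * sqnorm n)).
  by field; rewrite gt_eqF ?eta_gt0.
rewrite lerD ?ler_wpM2l ?sqr_ge0//.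
by rewrite divr_ge0 ?sqr_ge0.
Qed.

(** Young's inequality with parameter [delta / 2] uses half of the decrease
    given by [qform_lyapS].  The tracking error contributes to the first form
    through [eta *: z]; since [eta <= delta / 2], the decrease of the second
    form pays for it, and a decrease [delta / 2 * sqnorm a] is left. *)
Lemma lyap_step_drift k d (a z m : 'M[R]_(N, d)) (alpha : R) :
  q k.+1 (Wt k *m (a - eta *: z - alpha *: m)) +
  2 * q k.+1 (Wt k *m z - (alpha / eta) *: ((1%:M - W k) *m m)) <=
  q k a + 2 * q k z - delta / 2 * sqnorm a +
  4 / delta * alpha ^+ 2 * Q * sqnorm m.
Proof.
have d0 := delta_gt0 tau_gt0 lam_ge0 lam_lt1.
have d1 := delta_le1 lam tau_gt0.
have e0 := eta_gt0; have ed := eta_le_delta.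
have q0 j (X : 'M[R]_(N, d)) : 0 <= q j X by exact: qform_lyap_ge0.
have q1 j (X : 'M[R]_(N, d)) : q j X <= sqnorm X by exact: qform_lyap_le.
have qS (X : 'M[R]_(N, d)) : q k.+1 (Wt k *m X) = q k X - delta * sqnorm X.
  exact: qform_lyapS.
have s0 (X : 'M[R]_(N, d)) := sqnorm_ge0 X.
move: (delta) d0 d1 ed qS => D d0 d1 ed qS.
have b0 : 0 < D / 2 by lra.
have b1 : 1 + (D / 2)^-1 = 1 + 2 / D by rewrite invf_div.
(* The factor brought by Young's inequality is compensated by the contraction
   of [W k - Pi]: (1 + 2 / D) (1 - D) <= 2 / D. *)
have aux (X : 'M[R]_(N, d)) :
    (1 + 2 / D) * q k.+1 (Wt k *m X) <= 2 / D * sqnorm X.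
  rewrite qS; have := q1 k X; have := s0 X.
  have : 0 < 1 + 2 / D by rewrite addr_gt0 ?divr_gt0.
  move=> h hs hq.
  apply: (@le_trans _ _ ((1 + 2 / D) * ((1 - D) * sqnorm X))).
    by rewrite ler_pM2l//; lra.
  have -> : (1 + 2 / D) * ((1 - D) * sqnorm X) =
    2 / D * sqnorm X - (1 + D) * sqnorm X by field; rewrite gt_eqF.
  by rewrite gerBl mulr_ge0// ; lra.
have keep (X : 'M[R]_(N, d)) :
    (1 + D / 2) * q k.+1 (Wt k *m X) <= q k X - D / 2 * sqnorm X.
  rewrite qS; have := q1 k X; have := s0 X; nra.
have step1 : q k.+1 (Wt k *m (a - eta *: z - alpha *: m)) <=
   q k a - D / 2 * sqnorm a +
   2 / D * (2 * (eta ^+ 2 * sqnorm z) + 2 * (alpha ^+ 2 * sqnorm m)).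
  rewrite -addrA mulmxDr.
  apply: le_trans (qformD_young _ _ (q0 _) b0) _.
  rewrite b1; apply: lerD; first exact: keep.
  apply: le_trans (aux _) _.
  rewrite ler_pM2l ?divr_gt0// -(sqnormZ eta z) -(sqnormZ alpha m).
  rewrite -(sqnormN (eta *: z)); exact: sqnormB_le.
have step2 : q k.+1 (Wt k *m z - (alpha / eta) *: ((1%:M - W k) *m m)) <=
   q k z - D / 2 * sqnorm z +
   (1 + 2 / D) * (alpha ^+ 2 / eta ^+ 2 * (4 * sqnorm m)).
  apply: le_trans (qformD_young _ _ (q0 _) b0) _.
  rewrite b1; apply: lerD; first exact: keep.
  rewrite ler_wpM2l ?addr_ge0 ?divr_ge0 ?(ltW d0)//.
  rewrite -scaleNr qformZ sqrrN expr_div_n ler_wpM2l ?divr_ge0 ?sqr_ge0//.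
  exact: sub1_W_le.
have zcoef : 2 / D * (2 * (eta ^+ 2 * sqnorm z)) <= D * sqnorm z.
  have -> : 2 / D * (2 * (eta ^+ 2 * sqnorm z)) =
    (4 * eta ^+ 2) / D * sqnorm z by field; rewrite gt_eqF.
  rewrite ler_wpM2r// ler_pdivrMr//; nra.
have mcoef : 2 / D * (2 * (alpha ^+ 2 * sqnorm m)) +
    2 * ((1 + 2 / D) * (alpha ^+ 2 / eta ^+ 2 * (4 * sqnorm m))) <=
    4 / D * alpha ^+ 2 * Q * sqnorm m.
  have -> : 4 / D * alpha ^+ 2 * Q * sqnorm m =
     2 / D * (2 * (alpha ^+ 2 * sqnorm m)) +
     2 * (4 / D * (alpha ^+ 2 / eta ^+ 2 * (4 * sqnorm m))).
    by rewrite /Q_cst; field; rewrite !gt_eqF.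
  rewrite lerD2l ler_pM2l// ler_wpM2r//.
    by rewrite mulr_ge0 ?divr_ge0 ?sqr_ge0// mulr_ge0.
  have : 1 <= D^-1 by rewrite invf_ge1.
  lra.
lra.
Qed.

End LyapunovStep.

(** * Smooth convex functions *)

Section SmoothConvex.
Variables (R : realType) (d : nat).
Implicit Types (f : 'rV[R]_d -> R) (x y v : 'rV[R]_d).

Lemma derive_grad f x v : differentiable f x -> 'D_v f x = dot (grad f x) v.
Proof.
move=> df; rewrite deriveE// {1}(row_sum_delta v) linear_sum.
rewrite dotE big_ord1; apply: eq_bigr => j _.
by rewrite linearZ/= mxE deriveE// mulrC.
Qed.

Lemma is_derive_line f x v (t : R) :
  differentiable f (t *: v + x) ->
  is_derive t 1 (fun s : R => f (s *: v + x)) (dot (grad f (t *: v + x)) v).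
Proof.
move=> df.
have quotE : (fun h : R => h^-1 *: (((fun s : R => f (s *: v + x)) \o shift t) (h *: 1) -
      f (t *: v + x))) =
    (fun h : R => h^-1 *: ((f \o shift (t *: v + x)) (h *: v) - f (t *: v + x))).
  by apply/funext => h /=; rewrite [h *: 1]mulr1 scalerDl addrA.
split; first by rewrite /derivable quotE; exact: diff_derivable.
by rewrite /derive quotE -/(derive f _ v) derive_grad.
Qed.

(** By convexity the chord bounds the difference quotients at positive steps,
    whose limit is the directional derivative. *)
Lemma convex_grad_le f x y :
  convex_function [set: 'rV[R]_d] f -> differentiable f x ->
  f x + dot (grad f x) (y - x) <= f y.
Proof.
move=> cf df; rewrite -lerBrDl -derive_grad//.
have /cvg_dnbhs_at_right dfr := @diff_derivable _ _ _ f x (y - x) df.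
apply: (cvgr_to_le dfr); near=> h.
have h0 : 0 < h by near: h; exact: nbhs_right_gt.
have h1 : h <= 1 by near: h; exact: nbhs_right_le.
rewrite /= -[_ *: _]/(_ * _) mulrC ler_pdivrMr// mulrC.
have ch : f (h *: (y - x) + x) <= h * f y + (1 - h) * f x.
  have -> : h *: (y - x) + x = h *: y + (1 - h) *: x.
    by rewrite scalerBl scale1r scalerBr -addrA [_ - _ in RHS]addrC.
  exact: (cf (Itv01 (ltW h0) h1) y x (in_setT _) (in_setT _)).
rewrite /=; lra.
Unshelve. all: by end_near. Qed.

(** Along the segment, the difference between [f] and the quadratic bound has a
    nonpositive derivative. *)
Lemma smooth_descent (L : R) f x y :
  (forall z, differentiable f z) -> 0 < L -> smooth L f ->
  f y <= f x + dot (grad f x) (y - x) + L / 2 * sqnorm (y - x).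
Proof.
move=> df L0 sf; set v := y - x; set g := dot (grad f x) v.
pose phi (t : R) := f (t *: v + x) - g * t - L / 2 * sqnorm v * t ^+ 2.
pose dphi (t : R) := dot (grad f (t *: v + x)) v - g - L * sqnorm v * t.
have dphiP (t : R) : is_derive t 1 phi (dphi t).
  have h1 := is_derive_line (df (t *: v + x)).
  have h2 : is_derive t 1 (fun t : R => g * t + L / 2 * sqnorm v * t ^+ 2)
     (g + L * sqnorm v * t).
    apply: is_derive_eq; rewrite /GRing.scale /=. lra.
  have -> : phi = (fun s : R => f (s *: v + x)) -
      (fun t : R => g * t + L / 2 * sqnorm v * t ^+ 2).
    by apply/funext => s; rewrite /phi /= opprD addrA.
  apply: (is_derive_eq (is_deriveB h1 h2)); rewrite /dphi; lra.
have : phi 1 <= phi 0.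
  apply: (@ler0_derive1_nincr _ phi 0 1) => //.
  - move=> t /itvP t01; rewrite derive1E; have [_ ->] := dphiP t.
    have t0 : 0 < t by rewrite t01.
    rewrite /dphi /g -dotNl -dotDl.
    set e := grad f (t *: v + x) - grad f x.
    have : sqnorm e <= (L * t) ^+ 2 * sqnorm v.
      have := sf (t *: v + x) x; rewrite -/e addrK => /(l2norm_le_sqr (ltW L0)).
      by rewrite sqnormZ exprMn mulrA.
    have := sqnorm_ge0 (e - (L * t) *: v).
    rewrite sqnormB sqnormZ dotZr => h1 h2.
    have {h1} : 2 * (L * t) * dot e v <= 2 * (L * t) * (L * t * sqnorm v).
      by move: h1 h2; set c := L * t; rewrite expr2; lra.
    rewrite ler_pM2l ?mulr_gt0// subr_le0.
    by rewrite mulrAC.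
  - apply: continuous_subspaceT => t.
    apply/differentiable_continuous/derivable1_diffP; by have [] := dphiP t.
rewrite /phi scale1r scale0r add0r !mulr1 mulr0 expr1n expr0n /= mulr0 !subr0.
rewrite {1}/v subrK; lra.
Qed.

(** Compare, at the point minimizing their difference, the quadratic upper
    bound of [f] based at [x] with its linear lower bound based at [y]. *)
Lemma grad_cocoercive (L : R) f x y :
  (forall z, differentiable f z) -> 0 < L -> smooth L f ->
  convex_function [set: 'rV[R]_d] f ->
  sqnorm (grad f x - grad f y) <=
    2 * L * (f x - f y - dot (grad f y) (x - y)).
Proof.
move=> df L0 sf cf; set e := grad f x - grad f y.
pose z := x - L^-1 *: e.
have lower := convex_grad_le z cf (df y).
have upper := smooth_descent x z df L0 sf.
have zx : z - x = - (L^-1 *: e) by rewrite /z addrC addrA addNr add0r.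
have zy : z - y = (x - y) - L^-1 *: e by rewrite /z addrAC.
rewrite zx sqnormN sqnormZ dotNr dotZr in upper.
rewrite zy dotDr dotNr dotZr in lower.
have ee : sqnorm e = dot (grad f x) e - dot (grad f y) e.
  by rewrite sqnorm_dot {1}/e dotDl dotNl.
have E : L / 2 * (L^-1 ^+ 2 * sqnorm e) = 2^-1 * (L^-1 * sqnorm e).
  by field; rewrite gt_eqF.
have : L^-1 * sqnorm e <= 2 * (f x - f y - dot (grad f y) (x - y)).
  rewrite E in upper; rewrite {1}ee mulrBr.
  have : L^-1 * sqnorm e = L^-1 * dot (grad f x) e - L^-1 * dot (grad f y) e.
    by rewrite ee mulrBr.
  lra.
rewrite mulrC ler_pdivrMr// => h; lra.
Qed.

End SmoothConvex.

(** * Gradients of the stacked objective *)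

Section StackedObjective.
Variables (R : realType) (N d : nat).
Hypothesis N_gt0 : (0 < N)%N.
Variables (f : 'I_N -> 'rV[R]_d -> R) (L : R).
Hypothesis f_diff : forall i x, differentiable (f i) x.
Hypothesis L_gt0 : 0 < L.
Hypothesis f_convex : forall i, convex_function [set: 'rV[R]_d] (f i).
Hypothesis f_smooth : forall i, smooth L (f i).
Variable xstar : 'rV[R]_d.
Hypothesis xstar_min : forall x, favg f xstar <= favg f x.
Implicit Types (X Y : 'M[R]_(N, d)).

Local Notation consensus x := (\matrix_(i < N) x : 'M[R]_(N, d)).

Lemma N_neq0 : N%:R != 0 :> R. Proof. by rewrite pnatr_eq0 -lt0n. Qed.

Lemma avg_mxE X : avg_mx R N *m X = consensus (rowavg X).
Proof.
apply/row_matrixP => i; rewrite rowK /rowavg; apply/rowP => j.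
rewrite !mxE summxE mulr_sumr; apply: eq_bigr => k _.
by rewrite !mxE.
Qed.

Lemma sqnorm_consensus (x : 'rV[R]_d) : sqnorm (consensus x) = N%:R * sqnorm x.
Proof.
rewrite sqnorm_rows; under eq_bigr do rewrite rowK.
by rewrite sumr_const card_ord mulr_natl.
Qed.

Lemma avg_mx_doubly_stochastic : doubly_stochastic (avg_mx R N).
Proof.
split=> [i j||]; first by rewrite mxE invr_ge0.
- apply/matrixP => i j; rewrite !mxE; under eq_bigr do rewrite !mxE mulr1.
  by rewrite sumr_const card_ord -[LHS]mulr_natr mulVf ?N_neq0.
- apply/matrixP => i j; rewrite !mxE; under eq_bigr do rewrite !mxE mul1r.
  by rewrite sumr_const card_ord -[LHS]mulr_natr mulVf ?N_neq0.
Qed.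

Lemma sqnorm_rowavg_le X : sqnorm (rowavg X) <= N%:R^-1 * sqnorm X.
Proof.
rewrite ler_pdivlMl ?ltr0n// -sqnorm_consensus -avg_mxE.
exact/doubly_stochastic_contract/avg_mx_doubly_stochastic.
Qed.

Lemma rowavgD X Y : rowavg (X + Y) = rowavg X + rowavg Y.
Proof.
rewrite /rowavg -scalerDr -big_split/=; congr (_ *: _).
by apply: eq_bigr => i _; rewrite raddfD.
Qed.

Lemma rowavgZ a X : rowavg (a *: X) = a *: rowavg X.
Proof.
rewrite /rowavg scalerA [a * _]mulrC -scalerA; congr (_ *: _).
by rewrite scaler_sumr; apply: eq_bigr => i _; rewrite linearZ.
Qed.

Lemma rowavgB X Y : rowavg (X - Y) = rowavg X - rowavg Y.
Proof. by rewrite -scaleN1r rowavgD rowavgZ scaleN1r. Qed.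

Lemma rowavg_mul (A : 'M[R]_N) X : doubly_stochastic A -> rowavg (A *m X) = rowavg X.
Proof.
move=> dA; have i0 : 'I_N by exact: Ordinal N_gt0.
have := congr1 (row i0) (avg_mxE (A *m X)).
by rewrite mulmxA mul_avg_doubly_stochastic// avg_mxE !rowK.
Qed.

(** A gradient step from [xstar] would decrease [favg] by a multiple of the
    square norm of the mean gradient. *)
Lemma favg_grad_min : \sum_i grad (f i) xstar = 0.
Proof.
set g := \sum_i _.
pose z := xstar - (L^-1 * N%:R^-1) *: g.
have zx : z - xstar = - ((L^-1 * N%:R^-1) *: g).
  by rewrite /z addrAC subrr add0r.
have := xstar_min z; rewrite /favg ler_pM2l ?invr_gt0 ?ltr0n// => h1.
have : \sum_i f i z <= \sum_i (f i xstar + dot (grad (f i) xstar) (z - xstar) +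
    L / 2 * sqnorm (z - xstar)).
  by apply: ler_sum => i _; exact: smooth_descent.
rewrite big_split big_split/= -dot_suml -/g sumr_const card_ord.
rewrite zx sqnormN sqnormZ dotNr dotZr -sqnorm_dot -[X in _ + X]mulr_natl.
have -> : N%:R * (L / 2 * ((L^-1 / N%:R) ^+ 2 * sqnorm g)) =
    2^-1 * (L^-1 / N%:R * sqnorm g).
  by field; rewrite ?N_neq0 ?gt_eqF.
move=> h2.
have h3 : L^-1 / N%:R * sqnorm g <= 0 by lra.
apply: sqnorm_eq0; apply/eqP; rewrite eq_le sqnorm_ge0 andbT.
by move: h3; rewrite pmulr_rle0// divr_gt0 ?invr_gt0 ?ltr0n.
Qed.

Lemma favg_gapE x : N%:R * (favg f x - favg f xstar) = \sum_i (f i x - f i xstar).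
Proof.
by rewrite /favg -mulrBr mulrA mulfV ?N_neq0// mul1r sumrB.
Qed.

(** Go through the average iterate [xb]: the Lipschitz bound from [x_i] to
    [xb], cocoercivity from [xb] to [xstar].  The linear terms of the latter
    cancel in the sum over the agents by optimality of [xstar]. *)
Lemma full_grad_diff_le X :
  sqnorm (full_grad f X - full_grad f (consensus xstar)) <=
  2 * L ^+ 2 * sqnorm (centered X) +
  4 * L * N%:R * (favg f (rowavg X) - favg f xstar).
Proof.
set xb := rowavg X.
rewrite -[4 * L * N%:R * _]mulrA favg_gapE sqnorm_rows (sqnorm_rows (centered X)) !mulr_sumr.
have -> : \sum_i 4 * L * (f i xb - f i xstar) =
    \sum_i 4 * L * (f i xb - f i xstar - dot (grad (f i) xstar) (xb - xstar)).
  rewrite -!mulr_sumr; congr (_ * _).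
  by rewrite [RHS]sumrB -dot_suml favg_grad_min dot0l subr0.
rewrite -big_split/=; apply: ler_sum => i _.
rewrite raddfB/= !rowK.
have -> : row i (centered X) = row i X - xb.
  by rewrite /centered mulmxBl mul1mx avg_mxE raddfB/= rowK.
have -> : grad (f i) (row i X) - grad (f i) xstar =
   (grad (f i) (row i X) - grad (f i) xb) + (grad (f i) xb - grad (f i) xstar).
  by rewrite addrA subrK.
apply: le_trans (sqnormD_le _ _) _; apply: lerD.
  by rewrite -mulrA ler_pM2l//; apply: l2norm_le_sqr (ltW L_gt0) (f_smooth _ _ _).
have := grad_cocoercive xb xstar (f_diff i) L_gt0 (f_smooth i) (@f_convex i).
lra.
Qed.

Lemma rowavg_full_grad_consensus : rowavg (full_grad f (consensus xstar)) = 0.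
Proof.
rewrite /rowavg (eq_bigr (fun i => grad (f i) xstar)) ?favg_grad_min ?scaler0//.
by move=> i _; rewrite !rowK.
Qed.

Lemma favg_gap_ge0 x : 0 <= favg f x - favg f xstar.
Proof. by rewrite subr_ge0. Qed.

Lemma avg_grad_le X :
  N%:R * sqnorm (rowavg (full_grad f X)) <=
  2 * L ^+ 2 * sqnorm (centered X) +
  4 * L * N%:R * (favg f (rowavg X) - favg f xstar).
Proof.
apply: le_trans (full_grad_diff_le X).
rewrite -[rowavg _]subr0 -rowavg_full_grad_consensus -rowavgB.
by rewrite -ler_pdivlMl ?ltr0n// sqnorm_rowavg_le.
Qed.

(** For each agent, the smooth upper bound based at [x_i] is used at the average
    iterate and the convex lower bound based at [x_i] is used at [xstar]; their
    difference eliminates [f_i x_i]. *)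
Lemma avg_grad_dot_ge X :
  N%:R * (favg f (rowavg X) - favg f xstar) - L / 2 * sqnorm (centered X) <=
  N%:R * dot (rowavg (full_grad f X)) (rowavg X - xstar).
Proof.
set xb := rowavg X.
rewrite [X in dot X _]/rowavg dotZl mulrA mulfV ?N_neq0// mul1r dot_suml.
rewrite favg_gapE sqnorm_rows mulr_sumr -sumrB; apply: ler_sum => i _.
rewrite rowK.
have -> : row i (centered X) = row i X - xb.
  by rewrite /centered mulmxBl mul1mx avg_mxE raddfB/= rowK.
have h1 := smooth_descent (row i X) xb (f_diff i) L_gt0 (f_smooth i).
have h2 := convex_grad_le xstar (@f_convex i) (f_diff i (row i X)).
rewrite -(sqnormN (xb - _)) opprB in h1.
have -> : xb - xstar = (xb - row i X) - (xstar - row i X).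
  by rewrite opprB addrA subrK.
rewrite dotDr dotNr; lra.
Qed.

Lemma avg_step_drift X (alpha : R) : 0 <= alpha ->
  sqnorm (rowavg X - alpha *: rowavg (full_grad f X) - xstar) <=
  sqnorm (rowavg X - xstar)
  - (2 * alpha - 4 * alpha ^+ 2 * L) * (favg f (rowavg X) - favg f xstar)
  + (alpha + 2 * alpha ^+ 2 * L) * (L / N%:R * sqnorm (centered X)).
Proof.
move=> a0; set u := rowavg (full_grad f X).
rewrite [rowavg X - _ - _]addrAC (sqnormB (rowavg X - xstar)) sqnormZ dotZr.
rewrite [dot (_ - _) u]dotC.
have h1 := avg_grad_dot_ge X; have h2 := avg_grad_le X.
move: h1 h2; rewrite -/u.
set s := sqnorm (centered X); set D := dot u _; set U := sqnorm u.
set g := favg f _ - _; set e := sqnorm (_ - _).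
have N0 : 0 < N%:R :> R by rewrite ltr0n.
move=> h1 h2.
have {}h1 : g - (L / N%:R * s) / 2 <= D.
  rewrite -(ler_pM2l N0); apply: le_trans h1; rewrite le_eqVlt; apply/orP; left.
  by apply/eqP; field; exact: N_neq0.
have {}h2 : U <= 2 * L * (L / N%:R * s) + 4 * L * g.
  rewrite -(ler_pM2l N0); apply: le_trans h2 _; rewrite le_eqVlt; apply/orP; left.
  by apply/eqP; field; exact: N_neq0.
set t := L / N%:R * s in h1 h2 *.
have := ler_wpM2l a0 h1; have := ler_wpM2l (sqr_ge0 alpha) h2; lra.
Qed.

End StackedObjective.

(** * Square integrable variables and real expectations *)

Section RealExpectation.
Context {R : realType} {dO : measure_display} {Omega : measurableType dO}.
Variable P : probability Omega R.
Implicit Types X Y : Omega -> R.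

Definition intble X : Prop := P.-integrable setT (EFin \o X).
(** Real-valued so that the recursions live in an ordered field; it agrees with
    the extended expectation on integrable variables ([expectation_intble]). *)
Definition Ex X : R := \int[P]_w X w.
Definition sqint X : Prop :=
  measurable_fun setT X /\ intble (fun w => X w ^+ 2).

Lemma intble_measurable X : intble X -> measurable_fun setT X.
Proof. by move=> /measurable_int /measurable_EFinP. Qed.

Lemma intble_le X Y : measurable_fun setT X -> intble Y ->
  (forall w, `|X w| <= `|Y w|) -> intble X.
Proof.
move=> mX iY XY; apply: (le_integrable measurableT _ _ iY).
  exact/measurable_EFinP.
by move=> w _; rewrite /= lee_fin.
Qed.

Lemma intbleD X Y : intble X -> intble Y -> intble (fun w => X w + Y w).
Proof. by move=> iX iY; exact: (integrableD measurableT iX iY). Qed.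

Lemma intbleZ a X : intble X -> intble (fun w => a * X w).
Proof. by move=> iX; exact: (integrableZl measurableT a iX). Qed.

Lemma intbleN X : intble X -> intble (fun w => - X w).
Proof.
by move=> iX; under eq_fun do rewrite -mulN1r; exact: intbleZ.
Qed.

Lemma intbleB X Y : intble X -> intble Y -> intble (fun w => X w - Y w).
Proof. by move=> iX iY; apply: intbleD => //; exact: intbleN. Qed.

Lemma intble_cst a : intble (fun=> a).
Proof. exact: finite_measure_integrable_cst. Qed.

Lemma intble_sum I (r : seq I) (X : I -> Omega -> R) :
  (forall i, intble (X i)) -> intble (fun w => \sum_(i <- r) X i w).
Proof.
move=> iX; elim: r => [|i r IHr].
  by under eq_fun do rewrite big_nil; exact: intble_cst.
by under eq_fun do rewrite big_cons; exact: intbleD.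
Qed.

Lemma expectation_intble X : intble X -> ('E_P[X])%E = (Ex X)%:E.
Proof. by move=> iX; rewrite unlock /Ex /Rintegral fineK//; exact: integrable_fin_num. Qed.

Lemma ExD X Y : intble X -> intble Y -> Ex (fun w => X w + Y w) = Ex X + Ex Y.
Proof. exact: RintegralD. Qed.

Lemma ExB X Y : intble X -> intble Y -> Ex (fun w => X w - Y w) = Ex X - Ex Y.
Proof. exact: RintegralB. Qed.

Lemma ExZ a X : intble X -> Ex (fun w => a * X w) = a * Ex X.
Proof. exact: RintegralZl. Qed.

Lemma Ex_cst a : Ex (fun=> a) = a.
Proof. by rewrite /Ex Rintegral_cst// [X in fine X]probability_setT mulr1. Qed.

Lemma Ex_sum I (r : seq I) (X : I -> Omega -> R) :
  (forall i, intble (X i)) ->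
  Ex (fun w => \sum_(i <- r) X i w) = \sum_(i <- r) Ex (X i).
Proof.
move=> iX; elim: r => [|i r IHr].
  by under eq_fun do rewrite big_nil; rewrite big_nil Ex_cst.
under eq_fun do rewrite big_cons.
by rewrite big_cons ExD// ?IHr//; exact: intble_sum.
Qed.

Lemma Ex_le X Y : intble X -> intble Y -> (forall w, X w <= Y w) -> Ex X <= Ex Y.
Proof. by move=> iX iY XY; exact: le_Rintegral. Qed.

Lemma Ex_ge0 X : (forall w, 0 <= X w) -> 0 <= Ex X.
Proof. by move=> X0; exact: Rintegral_ge0. Qed.

Lemma sqint_measurable X : sqint X -> measurable_fun setT X.
Proof. by case. Qed.

Lemma intbleM X Y : sqint X -> sqint Y -> intble (fun w => X w * Y w).
Proof.
move=> [mX iX] [mY iY].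
apply: (@intble_le _ (fun w => X w ^+ 2 + Y w ^+ 2)).
- exact: measurable_funM.
- exact: intbleD.
- move=> w; rewrite [leRHS]ger0_norm ?addr_ge0 ?sqr_ge0// ler_norml.
  have := sqr_ge0 (X w + Y w); have := sqr_ge0 (X w - Y w).
  have := sqr_ge0 (X w); have := sqr_ge0 (Y w).
  by move=> *; apply/andP; split; nra.
Qed.

Lemma sqint_le X Y : measurable_fun setT X -> intble Y ->
  (forall w, X w ^+ 2 <= Y w) -> sqint X.
Proof.
move=> mX iY XY; split => //; apply: (intble_le _ iY).
  exact: measurable_funX.
move=> w; rewrite ger0_norm ?sqr_ge0// ger0_norm//.
exact: le_trans (sqr_ge0 _) (XY w).
Qed.

Lemma sqintD X Y : sqint X -> sqint Y -> sqint (fun w => X w + Y w).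
Proof.
move=> [mX iX] [mY iY].
apply: (@sqint_le _ (fun w => 2 * X w ^+ 2 + 2 * Y w ^+ 2)).
- exact: measurable_funD.
- by apply: intbleD; exact: intbleZ.
- by move=> w; have := sqr_ge0 (X w - Y w); lra.
Qed.

Lemma sqintZ a X : sqint X -> sqint (fun w => a * X w).
Proof.
move=> [mX iX]; split; first exact: measurable_funM.
by under eq_fun do rewrite exprMn; exact: intbleZ.
Qed.

Lemma sqint_cst a : sqint (fun=> a).
Proof. by split; [exact: measurable_cst|exact: intble_cst]. Qed.

Lemma sqint_sum I (r : seq I) (X : I -> Omega -> R) :
  (forall i, sqint (X i)) -> sqint (fun w => \sum_(i <- r) X i w).
Proof.
move=> iX; elim: r => [|i r IHr].
  by under eq_fun do rewrite big_nil; exact: sqint_cst.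
by under eq_fun do rewrite big_cons; exact: sqintD.
Qed.

Lemma sqint_intble X : sqint X -> intble X.
Proof.
move=> sX; have := intbleM sX (sqint_cst 1).
by under eq_fun do rewrite mulr1.
Qed.

Lemma sqint_bounded X (b : R) : measurable_fun setT X ->
  (forall w, `|X w| <= b) -> sqint X.
Proof.
move=> mX Xb; apply: (@sqint_le _ (fun=> b ^+ 2)) => //; first exact: intble_cst.
by move=> w; rewrite -[X w ^+ 2]real_normK ?num_real// lerXn2r ?nnegrE// (le_trans _ (Xb w)).
Qed.

Lemma sqint_boundedM X Y (b : R) : measurable_fun setT X ->
  (forall w, `|X w| <= b) -> sqint Y -> sqint (fun w => X w * Y w).
Proof.
move=> mX Xb [mY iY]; apply: (@sqint_le _ (fun w => b ^+ 2 * Y w ^+ 2)).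
- exact: measurable_funM.
- exact: intbleZ.
move=> w; rewrite exprMn ler_wpM2r ?sqr_ge0//.
by rewrite -[X w ^+ 2]real_normK ?num_real// lerXn2r ?nnegrE// (le_trans _ (Xb w)).
Qed.

Lemma Ex_indic_setI X (A : set Omega) :
  Ex (fun w => X w * \1_A w) = \int[P]_(w in A) X w.
Proof.
rewrite [RHS]Rintegral_mkcond; apply: eq_Rintegral => w _.
by rewrite patchE indicE; case: ifP => _; rewrite ?mulr1 ?mulr0.
Qed.

Lemma le_norm_indicator T (A : set T) w : `|\1_A w : R| <= 1.
Proof. by rewrite indicE; case: (_ \in _); rewrite ?normr1 ?normr0. Qed.

End RealExpectation.

(** * Orthogonality to the functions of a random element *)

Section Orthogonality.
Context {R : realType} {dO : measure_display} {Omega : measurableType dO}.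
Variable P : probability Omega R.
Context {dT : measure_display} {T : measurableType dT}.
Variables (phi : Omega -> T) (n : Omega -> R).
Hypothesis m_phi : measurable_fun setT phi.
Hypothesis n_sqint : sqint P n.
Hypothesis n_orth : forall B, measurable B ->
  Ex P (fun w => n w * \1_B (phi w)) = 0.

Import HBNNSimple.

Let orth_nnsfun (s : {nnsfun T >-> R}) : Ex P (fun w => s (phi w) * n w) = 0.
Proof.
pose r := finmap.enum_fset (fset_set (range s)).
have sE w : s (phi w) * n w =
    \sum_(y <- r) y * (n w * \1_(s @^-1` [set y]) (phi w)).
  rewrite fimfunE fsbig_finite//= mulr_suml; apply: eq_bigr => y _.
  by rewrite -mulrA [n w * _]mulrC.
under eq_fun do rewrite sE.
have my y : measurable (s @^-1` [set y]) by exact: measurable_funPTI.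
have iy y : intble P (fun w => n w * \1_(s @^-1` [set y]) (phi w)).
  under eq_fun do rewrite mulrC; apply: sqint_intble.
  apply: (@sqint_boundedM _ _ _ _ _ _ 1) => //.
    by apply: measurableT_comp m_phi; exact: measurable_indic.
  by move=> w; exact: le_norm_indicator.
rewrite Ex_sum; last by move=> y; exact: intbleZ.
by rewrite big1// => y _; rewrite ExZ// n_orth// mulr0.
Qed.

Let orth_ge0 (a : T -> R) : measurable_fun setT a -> (forall t, 0 <= a t) ->
  sqint P (a \o phi) -> Ex P (fun w => a (phi w) * n w) = 0.
Proof.
move=> ma a0 sa.
have mEa : measurable_fun setT (EFin \o a) by exact/measurable_EFinP.
pose s := nnsfun_approx measurableT mEa.
have s_cvg t : s k t @[k --> \oo] --> a t.
  have /= h := @cvg_nnsfun_approx _ _ _ _ measurableT _ mEa _ t I.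
  by apply: (fine_cvg (h _)) => x _; rewrite lee_fin.
have s_le k t : s k t <= a t.
  rewrite -(cvg_lim _ (s_cvg t))//; apply: nondecreasing_cvgn_le.
    by move=> i j ij; have /lefP := nd_nnsfun_approx measurableT mEa ij; apply.
  by apply/cvg_ex; exists (a t).
have mn := sqint_measurable n_sqint.
have := @dominated_cvg _ _ _ P setT measurableT
  (fun k w => (s k (phi w) * n w)%:E) (fun w => (a (phi w) * n w)%:E)
  (fun w => (`|a (phi w) * n w|)%:E).
have H1 : forall k, measurable_fun setT (fun w => (s k (phi w) * n w)%:E).
  move=> k; apply/measurable_EFinP; apply: measurable_funM => //.
  by apply: measurableT_comp m_phi; exact: measurable_funPT.
have H2 : forall w, setT w ->
    (s k (phi w) * n w)%:E @[k --> \oo] --> (a (phi w) * n w)%:E.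
  by move=> w _; apply: cvg_EFin; [exact: nearW|apply: cvgMr_tmp; exact: s_cvg].
have H3 : P.-integrable setT (fun w => (`|a (phi w) * n w|)%:E).
  by apply: integrable_norm; exact: (intbleM sa n_sqint).
have H4 : forall k w, setT w ->
    (`|(s k (phi w) * n w)%:E| <= (`|a (phi w) * n w|)%:E)%E.
  move=> k w _; rewrite /= lee_fin !normrM ler_wpM2r//.
  by rewrite ger0_norm ?a0 ?(ger0_norm (a0 _))// s_le.
move=> /(_ H1 H2 (fun w _ => isT) H3 H4) cvgI.
have intE k : (\int[P]_w (s k (phi w) * n w)%:E = 0)%E.
  have := orth_nnsfun (s k); rewrite /Ex /Rintegral => h.
  have : (\int[P]_w (s k (phi w) * n w)%:E)%E \is a fin_num.
    apply: integrable_fin_num => //.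
    apply: (le_integrable measurableT (H1 k) _ H3) => w wT.
    by apply: le_trans (H4 k w wT) _; rewrite /= lee_fin normr_id.
  by move=> /fineK <-; rewrite h.
have : (\int[P]_w (s k (phi w) * n w)%:E)%E @[k --> \oo] --> (0 : \bar R)%E.
  by under eq_fun do rewrite intE; exact: cvg_cst.
move=> /(cvg_unique _ cvgI) h; rewrite /Ex /Rintegral.
by rewrite h.
Qed.

(** The hypothesis on [n] handles the simple functions of [phi], which
    approximate the positive and negative parts of [a] from below; dominated
    convergence concludes, [a \o phi] times [n] being integrable. *)
Lemma orthogonal_measurable (a : T -> R) : measurable_fun setT a ->
  sqint P (a \o phi) -> Ex P (fun w => a (phi w) * n w) = 0.
Proof.
move=> ma sa.
pose ap t := Num.max (a t) 0; pose an t := Num.max (- a t) 0.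
have aE t : a t = ap t - an t.
  by rewrite /ap /an; case: (lerP (a t) 0) => ?; case: (lerP (- a t) 0) => ?; lra.
have map : measurable_fun setT ap by exact: measurable_maxr.
have man : measurable_fun setT an.
  by apply: measurable_maxr => //; exact: measurable_funN.
have part (b : T -> R) : measurable_fun setT b -> (forall t, `|b t| <= `|a t|) ->
    sqint P (b \o phi).
  move=> mb ba; have [_ ia] := sa.
  apply: (sqint_le _ ia); first exact: measurableT_comp.
  move=> w /=; rewrite -(real_normK (num_real (b _))) -(real_normK (num_real (a _))).
  by apply: lerXn2r; rewrite ?nnegrE//; exact: ba.
have sap : sqint P (ap \o phi).
  apply: part => // t; rewrite /ap; case: (lerP (a t) 0) => _//; first by rewrite normr0.
have san : sqint P (an \o phi).
  apply: part => // t; rewrite /an; case: (lerP (- a t) 0) => _; first by rewrite normr0.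
  by rewrite normrN.
under eq_fun do rewrite aE mulrBl.
rewrite ExB; [|exact: (intbleM sap n_sqint)|exact: (intbleM san n_sqint)].
rewrite !orth_ge0 ?subr0// => t; rewrite /ap /an le_max lexx orbT//.
Qed.

End Orthogonality.

(** * Measurability of random gradients *)

Section Caratheodory.
Context {R : realType} {dT : measure_display} {T : measurableType dT}.
Context {dS : measure_display} {S : measurableType dS}.
Variables (d : nat) (F : 'rV[R]_d -> S -> R).
Hypothesis F_meas : forall x, measurable_fun setT (F x).
Variables (X : T -> 'rV[R]_d) (g : T -> S).
Hypothesis X_meas : forall j, measurable_fun setT (fun t => X t 0 j).
Hypothesis g_meas : measurable_fun setT g.

(* The integer grid cell of mesh 1 / (k + 1) containing X t. *)
Let cell k t : 'rV[int]_d := \row_j Num.floor (X t 0 j * k.+1%:R).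
Let corner k (z : 'rV[int]_d) : 'rV[R]_d := \row_j ((z 0 j)%:~R / k.+1%:R).

Let measurable_cell k z : measurable [set t | cell k t = z].
Proof.
have -> : [set t | cell k t = z] =
    \big[setI/setT]_(j < d) [set t | (z 0 j)%:~R <= X t 0 j * k.+1%:R < (z 0 j + 1)%:~R].
  apply/seteqP; split => t /=.
    move=> <-; rewrite -bigcap_seq => j _ /=; rewrite mxE.
    by rewrite floor_le floorD1_gt.
  rewrite -bigcap_seq => h; apply/rowP => j; rewrite mxE; apply: floor_def.
  by apply: (h j); rewrite /= mem_index_enum.
apply: bigsetI_measurable => j _.
have mj : measurable_fun setT (fun t => X t 0 j * k.+1%:R).
  by apply: measurable_funM => //; exact: measurable_cst.
have := mj measurableT _ (measurable_itv `[(z 0 j)%:~R, (z 0 j + 1)%:~R[).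
rewrite setTI; set A := _ @^-1` _; suff -> : A = [set t |
  (z 0 j)%:~R <= X t 0 j * k.+1%:R < (z 0 j + 1)%:~R] by [].
by apply/seteqP; split => t; rewrite /A /= in_itv.
Qed.

Let measurable_corner k : measurable_fun setT (fun t => F (corner k (cell k t)) (g t)).
Proof.
move=> _ B mB; rewrite setTI.
have -> : (fun t => F (corner k (cell k t)) (g t)) @^-1` B =
    \bigcup_(z : 'rV[int]_d) ([set t | cell k t = z] `&` g @^-1` (F (corner k z) @^-1` B)).
  apply/seteqP; split => t /=.
    by move=> h; exists (cell k t).
  by case=> z _ [/= <-].
apply: countable_bigcupT_measurable; first exact: countableP.
move=> z; apply: measurableI => //.
rewrite -[X in measurable X]setTI; apply: g_meas => //.
by rewrite -[X in measurable X]setTI; exact: F_meas.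
Qed.

(** Joint measurability is obtained from separate properties: with the point
    frozen at the corners of a countable grid only the measurability in the
    sample is involved, and continuity in the point lets the mesh tend to 0. *)
Lemma measurable_caratheodory : (forall s, continuous (F^~ s)) ->
  measurable_fun setT (fun t => F (X t) (g t)).
Proof.
move=> F_cont.
apply: (measurable_fun_cvg (h := fun k t => F (corner k (cell k t)) (g t))) => // t _.
suff cornerX : corner k (cell k t) @[k --> \oo] --> X t.
  exact: (cvg_comp _ _ cornerX (F_cont (g t) (X t))).
apply: cvg_mx_entries => i j; rewrite ord1.
apply/cvgrPdist_le => e e0; near=> k.
rewrite !mxE ler_norml; set y := X t 0 j.
have k0 : 0 < k.+1%:R :> R by rewrite ltr0n.
have ke : k.+1%:R^-1 <= e.
  by apply: ltW; near: k; exact: (near_infty_natSinv_lt (PosNum e0)).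
have := floor_le (y * k.+1%:R); have := floorD1_gt (y * k.+1%:R).
rewrite intrD; set z := (Num.floor _)%:~R => h1 h2.
have {}h2 : z / k.+1%:R <= y by rewrite ler_pdivrMr.
have {}h1 : y < z / k.+1%:R + k.+1%:R^-1.
  by rewrite -[X in _ + X]mul1r -mulrDl ltr_pdivlMr.
have aux (a b c r : R) : b <= a -> a < b + c -> c <= r -> 0 < r -> - r <= a - b <= r.
  by move=> *; apply/andP; split; lra.
exact: aux h2 h1 ke e0.
Unshelve. all: by end_near. Qed.

End Caratheodory.

(** Partial derivatives are limits of difference quotients along the steps
    [1 / (k + 1)]. *)
Lemma measurable_grad {R : realType} {dT dS : measure_display}
    {T : measurableType dT} {S : measurableType dS}
    d (F : 'rV[R]_d -> S -> R) (X : T -> 'rV[R]_d) (g : T -> S) j :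
  (forall x, measurable_fun setT (F x)) ->
  (forall s x, differentiable (F^~ s) x) ->
  (forall j, measurable_fun setT (fun t => X t 0 j)) ->
  measurable_fun setT g ->
  measurable_fun setT (fun t => grad (F^~ (g t)) (X t) 0 j).
Proof.
move=> F_meas F_diff X_meas g_meas.
have F_cont s : continuous (F^~ s) by move=> x; exact: differentiable_continuous.
pose v : 'rV[R]_d := delta_mx 0 j.
apply: (measurable_fun_cvg (h := fun k t =>
    k.+1%:R * (F (k.+1%:R^-1 *: v + X t) (g t) - F (X t) (g t)))) => [k|t _].
  apply: measurable_funM; first exact: measurable_cst.
  apply: measurable_funB; last exact: measurable_caratheodory.
  apply: measurable_caratheodory => // i.
  under eq_fun do rewrite mxE.
  by apply: measurable_funD => //; exact: measurable_cst.
rewrite mxE.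
have dfr := @diff_derivable _ _ _ _ _ v (F_diff (g t) (X t)).
have h0 : (k.+1%:R^-1 : R) @[k --> \oo] --> (0 : R)^'.
  move=> A hA; have hA' := @cvg_harmonic R _ hA.
  apply: (@filterS nat \oo _ [set k | harmonic k != 0 :> R -> A (harmonic k)]) => // k.
  by apply; rewrite /harmonic /= invr_eq0 pnatr_eq0.
have := cvg_comp _ _ h0 dfr.
set u := (u in u @ _ --> _ -> _) => ucvg.
rewrite (_ : (fun _ => _) = u)//; apply/funext => k.
by rewrite /u /= invrK.
Qed.

(** * Conditioning on a sub-sigma-algebra *)

Section SubSigmaAlgebra.
Context {R : realType} {dO : measure_display} {Omega : measurableType dO}.
Variable P : probability Omega R.
Variable G : set (set Omega).
Hypothesis G_sigma : sigma_algebra setT G.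
Hypothesis G_meas : G `<=` measurable.

Local Notation OmegaG := (g_sigma_algebraType G).

Lemma measurable_sub (A : set OmegaG) : measurable A <-> G A.
Proof. by rewrite /measurable /= sigma_algebra_id. Qed.

Lemma measurable_fun_to_sub :
  measurable_fun setT ((fun w => w) : Omega -> OmegaG).
Proof. by move=> _ A /measurable_sub GA; rewrite setTI; exact: G_meas. Qed.

Lemma sub_measurableP (X : Omega -> R) :
  sub_measurable G X <-> measurable_fun setT (X : OmegaG -> R).
Proof.
split=> [mX _ B mB|mX B mB]; first by rewrite setTI; apply/measurable_sub; exact: mX.
by apply/measurable_sub; rewrite -[X in measurable X]setTI; exact: mX.
Qed.

Lemma sub_measurable_fun (X : Omega -> R) :
  sub_measurable G X -> measurable_fun setT X.
Proof. by move=> mX _ B mB; rewrite setTI; apply: G_meas; exact: mX. Qed.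

Lemma is_cond_exp_Ex (X Y : Omega -> R) A : is_cond_exp P G X Y -> G A ->
  Ex P (fun w => X w * \1_A w) = Ex P (fun w => Y w * \1_A w).
Proof. by case=> _ _ _ XY /XY AXY; rewrite !Ex_indic_setI /Rintegral AXY. Qed.

Lemma intble_indic (X : Omega -> R) (A : set Omega) : measurable A ->
  intble P X -> intble P (fun w => X w * \1_A w).
Proof.
move=> mA iX; apply: (intble_le _ iX).
  by apply: measurable_funM; [exact: intble_measurable iX|exact: measurable_indic].
by move=> w; rewrite normrM ler_piMr// le_norm_indicator.
Qed.

(** Integrate over the event where [g] is negative. *)
Lemma ae_ge0_of_sub (g : Omega -> R) : sub_measurable G g -> intble P g ->
  (forall A, G A -> 0 <= Ex P (fun w => g w * \1_A w)) ->
  {ae P, forall w, 0 <= g w}.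
Proof.
move=> mg ig g0; pose A := g @^-1` `]-oo, 0[.
have GA : G A by apply: mg; exact: measurable_itv.
have mA := G_meas GA.
pose h w := - (g w * \1_A w).
have ih : intble P h by apply: intbleN; exact: intble_indic.
have h0 w : 0 <= h w.
  rewrite /h oppr_ge0 indicE; case: (boolP (w \in A)); rewrite ?mulr0// mulr1.
  by rewrite inE /A /= in_itv /= => /ltW.
have Eh : (\int[P]_w `|(h w)%:E| = 0)%E.
  have : Ex P h = 0.
    apply/eqP; rewrite eq_le Ex_ge0// andbT.
    have -> : Ex P h = - Ex P (fun w => g w * \1_A w).
      rewrite -mulN1r -ExZ; last exact: intble_indic.
      by apply: eq_Rintegral => w _; rewrite mulN1r.
    by rewrite oppr_le0 g0.
  rewrite /Ex /Rintegral => Eh.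
  under eq_integral do rewrite /= ger0_norm//.
  by rewrite -[LHS]fineK ?Eh//; exact: integrable_fin_num.
have mh : measurable_fun setT (EFin \o h) by exact: measurable_int ih.
have := (ae_eq_integral_abs P measurableT mh).1 Eh.
apply: filterS => w /(_ I) /= [hw].
rewrite leNgt; apply/negP => gw; move: hw; rewrite /h indicE.
rewrite mem_set /A /= ?in_itv//= mulr1 => /eqP; rewrite oppr_eq0.
by rewrite lt_eqF.
Qed.

Lemma cond_exp_uniq (X Y Z : Omega -> R) :
  is_cond_exp P G X Y -> is_cond_exp P G X Z -> {ae P, forall w, Y w = Z w}.
Proof.
move=> hY hZ.
have [_ iY mY _] := hY; have [_ iZ mZ _] := hZ.
have le (U V : Omega -> R) : is_cond_exp P G X U -> is_cond_exp P G X V ->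
    {ae P, forall w, 0 <= U w - V w}.
  move=> hU hV; have [_ iU mU _] := hU; have [_ iV mV _] := hV.
  apply: ae_ge0_of_sub.
  - by apply/sub_measurableP; apply: measurable_funB; exact/sub_measurableP.
  - exact: intbleB.
  - move=> A GA; have mA := G_meas GA; under eq_fun do rewrite mulrBl.
    by rewrite ExB ?(is_cond_exp_Ex hU GA) -?(is_cond_exp_Ex hU GA)
      -?(is_cond_exp_Ex hV GA) ?subrr//; exact: intble_indic.
move: (le _ _ hY hZ) (le _ _ hZ hY); apply: filterS2 => w.
by rewrite !subr_ge0 => h1 h2; apply/eqP; rewrite eq_le h1 h2.
Qed.

Lemma Ex_ae_eq (X Y : Omega -> R) : measurable_fun setT X -> measurable_fun setT Y ->
  {ae P, forall w, X w = Y w} -> Ex P X = Ex P Y.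
Proof.
move=> mX mY XY; rewrite /Ex /Rintegral; congr fine.
apply: ae_eq_integral => //; try exact/measurable_EFinP.
by apply: filterS XY => w XYw _; rewrite XYw.
Qed.

(** Clipping a version changes it on a null set only, and makes it bounded, so
    that products of conditional probabilities are square integrable. *)
Lemma cond_prob_unit (E : set Omega) (p : Omega -> R) : measurable E ->
  is_cond_exp P G (\1_E) p ->
  exists q : Omega -> R,
    [/\ is_cond_exp P G (\1_E) q, forall w, 0 <= q w <= 1 &
        {ae P, forall w, p w = q w}].
Proof.
move=> mE hp; have [i1 ip mp hpE] := hp.
pose q w := Num.max 0 (Num.min 1 (p w)).
have q01 w : 0 <= q w <= 1.
  rewrite /q le_max lexx /= ge_max ler01 /= ge_min lexx //.
have mq' : measurable_fun setT (q : OmegaG -> R).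
  apply: measurable_maxr; first exact: measurable_cst.
  by apply: measurable_minr; [exact: measurable_cst|exact/sub_measurableP].
have mq : sub_measurable G q by exact/sub_measurableP.
have p_ge0 : {ae P, forall w, 0 <= p w}.
  apply: ae_ge0_of_sub => // A GA; rewrite -(is_cond_exp_Ex hp GA).
  by apply: Ex_ge0 => w; rewrite mulr_ge0// indicE.
have p_le1 : {ae P, forall w, 0 <= 1 - p w}.
  apply: ae_ge0_of_sub.
  - by apply/sub_measurableP; apply: measurable_funB; [exact: measurable_cst|exact/sub_measurableP].
  - by apply: intbleB => //; exact: intble_cst.
  - move=> A GA; have mA := G_meas GA; under eq_fun do rewrite mulrBl.
    rewrite ExB; [|exact: intble_indic (intble_cst _ _)|exact: intble_indic].
    rewrite -(is_cond_exp_Ex hp GA) -ExB; [|exact: intble_indic (intble_cst _ _)|exact: intble_indic].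
    apply: Ex_ge0 => w; rewrite -mulrBl mulr_ge0 ?indicE//.
    by rewrite subr_ge0; case: (_ \in _).
have pq : {ae P, forall w, p w = q w}.
  move: p_ge0 p_le1; apply: filterS2 => w p0; rewrite subr_ge0 => p1.
  by rewrite /q (min_r p1) (max_r p0).
have iq : intble P q.
  apply: sqint_intble; apply: (@sqint_bounded _ _ _ _ _ 1); first exact: sub_measurable_fun.
  by move=> w; have /andP[q0 q1] := q01 w; rewrite ger0_norm.
exists q; split => //; split => //.
- move=> A GA; rewrite hpE//; apply: ae_eq_integral => //.
  + exact: G_meas.
  + by apply/measurable_EFinP; apply: measurable_funTS; exact: sub_measurable_fun.
  + by apply/measurable_EFinP; apply: measurable_funTS; exact: sub_measurable_fun.
  + by apply: filterS pq => w pqw _; rewrite pqw.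
Qed.

(** The pull-out property of conditional expectations, integrated over the
    whole space. *)
Lemma orthogonal_sub (a n : Omega -> R) : sqint P n ->
  (forall A, G A -> Ex P (fun w => n w * \1_A w) = 0) ->
  sub_measurable G a -> sqint P a -> Ex P (fun w => a w * n w) = 0.
Proof.
move=> sn n0 ma sa.
apply: (@orthogonal_measurable _ _ _ P _ OmegaG (fun w => w) n
   measurable_fun_to_sub sn _ a) => //.
  by move=> B /measurable_sub; exact: n0.
exact/sub_measurableP.
Qed.

End SubSigmaAlgebra.

(** * Conditional independence *)

Section ConditionalIndependence.
Context {R : realType} {dO : measure_display} {Omega : measurableType dO}.
Variable P : probability Omega R.
Variable G : set (set Omega).
Hypothesis G_sigma : sigma_algebra setT G.
Hypothesis G_meas : G `<=` measurable.
Context {I : finType} {dX : measure_display}.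
Variables (S : I -> measurableType dX) (Y : forall i, Omega -> S i).
Hypothesis Y_meas : forall i, measurable_fun setT (Y i).
Hypothesis Y_indep : cond_independent P G Y.
Variables i j : I.
Hypothesis ij : i != j.

Local Notation OmegaG := (g_sigma_algebraType G).

Let measY l (A : set (S l)) : measurable A -> measurable (Y l @^-1` A).
Proof. by move=> mA; rewrite -[X in measurable X]setTI; exact: Y_meas. Qed.

(** Conditional independence speaks of one set for every agent; the agents
    other than [i] and [j] are left unconstrained. *)
Let two (A : set (S i)) (B : set (S j)) : forall l, set (S l) :=
  dfwith (dfwith (fun l => [set: S l]) i A) j B.

Let two_i A B : @two A B i = A.
Proof. by rewrite /two dfwithout ?dfwithin// eq_sym. Qed.

Let two_j A B : @two A B j = B.
Proof. by rewrite /two dfwithin. Qed.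

Let two_out A B l : l != i -> l != j -> @two A B l = setT.
Proof. by move=> li lj; rewrite /two !dfwithout// eq_sym. Qed.

Let measurable_two A B : measurable A -> measurable B ->
  forall l, measurable (@two A B l).
Proof.
move=> mA mB l; have [->|lj] := eqVneq l j; first by rewrite two_j.
by have [->|li] := eqVneq l i; [rewrite two_i|rewrite two_out].
Qed.

(** The product rule comes with versions of the conditional probabilities that
    depend on both sets; uniqueness trades them for fixed ones. *)
Let cond_prob_two A B qA qB : measurable A -> measurable B ->
  is_cond_exp P G (\1_(Y i @^-1` A)) qA -> is_cond_exp P G (\1_(Y j @^-1` B)) qB ->
  forall C, G C ->
  Ex P (fun w => \1_(Y i @^-1` A) w * \1_(Y j @^-1` B) w * \1_C w) =
  Ex P (fun w => qA w * qB w * \1_C w).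
Proof.
move=> mA mB hA hB C GC.
have [p [hp hprod]] := Y_indep (measurable_two mA mB).
have pA : {ae P, forall w, p i w = qA w}.
  by apply: (cond_exp_uniq G_sigma G_meas _ hA); have := hp i; rewrite two_i.
have pB : {ae P, forall w, p j w = qB w}.
  by apply: (cond_exp_uniq G_sigma G_meas _ hB); have := hp j; rewrite two_j.
have p1 : {ae P, forall w, forall l, l != i -> l != j -> p l w = 1}.
  apply: filter_forall => l.
  have [/eqP->|li] := boolP (l == i); first by apply: filterE => w; move/eqP.
  have [/eqP->|lj] := boolP (l == j); first by apply: filterE => w _ /eqP.
  suff h1 : is_cond_exp P G (\1_(Y l @^-1` (@two A B l))) (fun=> 1).
    by apply: filterS (cond_exp_uniq G_sigma G_meas (hp l) h1).
  rewrite two_out// preimage_setT.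
  have i1 : intble P (fun=> 1) by exact: intble_cst.
  have E1 : (\1_[set: Omega] : Omega -> R) = fun=> 1.
    by apply/funext => w; rewrite indicE in_setT.
  rewrite E1; split => //.
  by apply/(sub_measurableP G_sigma); exact: measurable_cst.
rewrite (_ : (fun w => _ * _ * _) =
    fun w => \1_(\bigcap_l (Y l @^-1` @two A B l)) w * \1_C w); last first.
  apply/funext => w; congr (_ * _).
  rewrite -[LHS]/((\1_(Y i @^-1` A) \* \1_(Y j @^-1` B)) w) -indicI.
  congr (\1_ _ w); apply/seteqP; split => t.
    move=> [tA tB] l _ /=; have [->|lj] := eqVneq l j; first by rewrite two_j.
    by have [->|li] := eqVneq l i; [rewrite two_i|rewrite two_out].
  by move=> h; split; [have := h i Logic.I; rewrite /= two_i|have := h j Logic.I; rewrite /= two_j].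
rewrite (is_cond_exp_Ex hprod GC).
have [_ ip mp _] := hprod.
have [_ iqA mqA _] := hA; have [_ iqB mqB _] := hB.
have mC := G_meas GC.
apply: Ex_ae_eq.
- apply: measurable_funM; last exact: measurable_indic.
  exact: sub_measurable_fun mp.
- apply: measurable_funM; last exact: measurable_indic.
  by apply: measurable_funM; [exact: (sub_measurable_fun G_meas mqA)|exact: (sub_measurable_fun G_meas mqB)].
- move: pA pB p1; apply: filterS3 => w wA wB w1; congr (_ * _).
  rewrite (bigD1 i)//= (bigD1 j) ?(eq_sym j)//= wA wB big1 ?mulr1// => l /andP[li lj].
  exact: w1.
Qed.

Let pair l (w : Omega) : OmegaG * S l := (w, Y l w).

Let measurable_pair l : measurable_fun setT (pair l).
Proof. by apply: measurable_fun_pair => //; exact: measurable_fun_to_sub. Qed.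

(** The events of [G] constrained by a set of values of [Y l] form a pi-system
    generating all events described by the past and [Y l]. *)
Let orth_rect l (n : Omega -> R) : sqint P n ->
  (forall C A, G C -> measurable A ->
    Ex P (fun w => n w * (\1_C w * \1_(Y l @^-1` A) w)) = 0) ->
  forall Z, measurable Z -> Ex P (fun w => n w * \1_Z (pair l w)) = 0.
Proof.
move=> sn nrect.
have in_pair (Z : set (OmegaG * S l)) w : \1_Z (pair l w) = \1_(pair l @^-1` Z) w :> R.
  by rewrite !indicE; congr (_%:R); apply/idP/idP; rewrite !inE.
have in_ := sqint_intble sn.
have mpre (Z : set (OmegaG * S l)) : measurable Z -> measurable (pair l @^-1` Z).
  by move=> mZ; rewrite -[X in measurable X]setTI; exact: measurable_pair.
have GT : G setT by have [h0 hC _] := G_sigma; have := hC _ h0; rewrite setD0.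
have ET : Ex P n = 0.
  rewrite -[RHS](nrect setT setT GT measurableT); apply: eq_Rintegral => w _.
  by rewrite preimage_setT indicE in_setT !mulr1.
have zero Z : measurable Z -> Ex P (fun w => n w * \1_Z (pair l w)) = 0 ->
    (\int[P]_(w in pair l @^-1` Z) (n w)%:E = 0)%E.
  move=> mZ; under eq_fun do rewrite in_pair.
  rewrite Ex_indic_setI /Rintegral => h.
  rewrite -[LHS]fineK ?h//; apply: integrable_fin_num; first exact: mpre.
  exact: (integrableS measurableT (mpre _ mZ) (@subsetT _ _) in_).
move=> Z mZ; have := mZ; rewrite measurable_prod_measurableType; move: Z {mZ}.
apply: (@dynkin_induction _ (OmegaG * S l)%type _
  (fun Z => Ex P (fun w => n w * \1_Z (pair l w)) = 0)
  (measurable_prod_measurableType _ _)).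
- move=> _ _ [C mC [A mA <-]] [C' mC' [A' mA' <-]].
  exists (C `&` C'); first exact: measurableI.
  exists (A `&` A'); first exact: measurableI.
  by rewrite setXI.
- by under eq_fun do rewrite indicE in_setT mulr1.
- move=> _ [C mC [A mA <-]].
  rewrite -[RHS](nrect C A) //; last exact/(measurable_sub G_sigma).
  apply: eq_Rintegral => w _; congr (_ * _).
  rewrite in_pair -[RHS]/((\1_C \* \1_(Y l @^-1` A)) w) -indicI.
  by congr (\1_ _ w).
- move=> Z mZ hZ; have mZ' := mpre _ mZ.
  rewrite (_ : (fun w => _) = fun w => n w - n w * \1_Z (pair l w)).
    rewrite ExB ?ET ?hZ ?subrr//; under eq_fun do rewrite in_pair.
    exact: intble_indic.
  apply/funext => w; rewrite !indicE in_setC; case: (_ \in Z).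
    by rewrite mulr0 mulr1 subrr.
  by rewrite mulr0 mulr1 subr0.
- move=> F mF tF hF.
  under eq_fun do rewrite in_pair.
  rewrite Ex_indic_setI preimage_bigcup /Rintegral integral_bigcup.
  + by rewrite eseries0// => k _ _; exact: zero.
  + by apply/trivIsetP => a b _ _ ab; rewrite -preimage_setI;
      move/trivIsetP : tF => ->//; rewrite preimage_set0.
  + by move=> k; exact: mpre.
  + apply: (integrableS measurableT _ (@subsetT _ _) in_).
    by apply: bigcup_measurable => k _; exact: mpre.
Qed.

(** By [orthogonal_measurable] it suffices to test the first variable against
    the indicator of an event of [G] constrained by [Y j].  Split this indicator
    into its conditional probability and a remainder.  The first variable is
    orthogonal to the conditional probability, which depends on the past only;
    by conditional independence the remainder integrates to 0 over every event
    described by the past and [Y i], hence is orthogonal to the functions of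
    these, the first variable among them. *)
Lemma cond_independent_orthogonal (U : OmegaG * S i -> R) (V : OmegaG * S j -> R) :
  measurable_fun setT U -> measurable_fun setT V ->
  sqint P (fun w => U (w, Y i w)) -> sqint P (fun w => V (w, Y j w)) ->
  (forall C, G C -> Ex P (fun w => U (w, Y i w) * \1_C w) = 0) ->
  Ex P (fun w => U (w, Y i w) * V (w, Y j w)) = 0.
Proof.
move=> mU mV sU sV U0.
under eq_fun do rewrite mulrC.
have h := @orthogonal_measurable _ _ _ P _ _ (pair j) (fun w => U (w, Y i w))
  (@measurable_pair j) sU _ V mV sV.
apply: h.
apply: orth_rect => // C B GC mB.
have ipr l (A : set (S l)) : measurable A ->
    exists p, is_cond_exp P G (\1_(Y l @^-1` A)) p.
  move=> mA.
  have mall : forall l', measurable (dfwith (fun l => [set: S l]) l A l').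
    by move=> l'; have [<-|ll] := eqVneq l l'; [rewrite dfwithin|rewrite dfwithout].
  have [p [hp _]] := Y_indep mall.
  by exists (p l); have := hp l; rewrite dfwithin.
have unit l (A : set (S l)) (mA : measurable A) : exists q : Omega -> R,
    is_cond_exp P G (\1_(Y l @^-1` A)) q /\ forall w, 0 <= q w <= 1.
  have [p hp] := ipr _ _ mA.
  have [q [hq q01 _]] := cond_prob_unit G_sigma G_meas (measY mA) hp.
  by exists q.
have unit_norm (q : Omega -> R) : (forall w, 0 <= q w <= 1) -> forall w, `|q w| <= 1.
  by move=> q01 w; have /andP[? ?] := q01 w; rewrite ger0_norm.
have mC := G_meas GC.
have [q [hq q01]] := unit j B mB.
have [_ iq mq _] := hq.
have mq' := sub_measurable_fun G_meas mq.
have subC C' : G C' -> sub_measurable G (\1_C' : Omega -> R).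
  move=> GC'; apply/(sub_measurableP G_sigma).
  by apply: measurable_indic; exact/(measurable_sub G_sigma).
(* The indicator minus its conditional probability, localized on C. *)
pose n w := \1_C w * (\1_(Y j @^-1` B) w - q w).
have sq : sqint P q by apply: (@sqint_bounded _ _ _ _ _ 1) => //; exact: unit_norm.
have sind E : measurable E -> sqint P (\1_E).
  move=> mE; apply: (@sqint_bounded _ _ _ _ _ 1); first exact: measurable_indic.
  exact: le_norm_indicator.
have sB := sind _ (measY mB).
have sdiff : sqint P (fun w => \1_(Y j @^-1` B) w - q w).
  have := sqintD sB (sqintZ (-1) sq); under eq_fun do rewrite mulN1r.
  by [].
have sqint_indic (E : set Omega) (Z : Omega -> R) : measurable E -> sqint P Z ->
    sqint P (fun w => \1_E w * Z w).
  move=> mE sZ; apply: (@sqint_boundedM _ _ _ P (\1_E) Z 1) => //.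
  exact: le_norm_indicator.
have sn : sqint P n by exact: sqint_indic.
have Un : Ex P (fun w => U (w, Y i w) * n w) = 0.
  apply: (@orthogonal_measurable _ _ _ P _ _ (pair i) n (@measurable_pair i) sn _ U mU sU).
  apply: orth_rect => // C' A GC' mA.
  have [r [hr r01]] := unit i A mA.
  have [_ ir mr _] := hr.
  have GCC : G (C `&` C').
    apply/(measurable_sub G_sigma).
    by apply: (@measurableI _ OmegaG); apply/(measurable_sub G_sigma).
  have mr' := sub_measurable_fun G_meas mr.
  have sr : sqint P r by apply: (@sqint_bounded _ _ _ _ _ 1) => //; exact: unit_norm.
  have sA := sind _ (measY mA).
  have i1 : intble P (fun w => \1_(Y i @^-1` A) w * \1_(Y j @^-1` B) w).
    exact: intbleM.
  have i2 : intble P (fun w => \1_(Y i @^-1` A) w * q w) by exact: intbleM.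
  have i3 : intble P (fun w => r w * q w) by exact: intbleM.
  have mCC := G_meas GCC.
  have -> : (fun w => n w * (\1_C' w * \1_(Y i @^-1` A) w)) =
     (fun w => \1_(Y i @^-1` A) w * \1_(Y j @^-1` B) w * \1_(C `&` C') w
             - \1_(Y i @^-1` A) w * q w * \1_(C `&` C') w).
    by apply/funext => w; rewrite /n indicI /=; ring.
  rewrite ExB; [|exact: intble_indic|exact: intble_indic].
  rewrite (cond_prob_two mA mB hr hq GCC).
  rewrite -ExB; [|exact: intble_indic|exact: intble_indic].
  have sdA : sqint P (fun w => r w - \1_(Y i @^-1` A) w).
    have := sqintD sr (sqintZ (-1) sA); under eq_fun do rewrite mulN1r.
    by [].
  have := @orthogonal_sub _ _ _ P G G_sigma G_meas (fun w => q w * \1_(C `&` C') w)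
    (fun w => r w - \1_(Y i @^-1` A) w) sdA.
  move=> h; rewrite -[RHS]h; first by apply: eq_Rintegral => w _; ring.
  - move=> D GD; under eq_fun do rewrite mulrBl.
    have mD := G_meas GD.
    rewrite ExB; [|exact: intble_indic (sqint_intble sr)|exact: intble_indic (sqint_intble sA)].
    by rewrite (is_cond_exp_Ex hr GD) subrr.
  - apply/(sub_measurableP G_sigma); apply: measurable_funM.
      exact/(sub_measurableP G_sigma).
    by apply/(sub_measurableP G_sigma); exact: subC.
  - under eq_fun do rewrite mulrC.
    exact: sqint_indic.
have Uq : Ex P (fun w => (q w * \1_C w) * U (w, Y i w)) = 0.
  apply: (orthogonal_sub G_sigma G_meas) => //.
  - apply/(sub_measurableP G_sigma); apply: measurable_funM.
      exact/(sub_measurableP G_sigma).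
    by apply/(sub_measurableP G_sigma); exact: subC.
  - under eq_fun do rewrite mulrC.
    exact: sqint_indic.
have -> : (fun w => U (w, Y i w) * (\1_C w * \1_(Y j @^-1` B) w)) =
   (fun w => U (w, Y i w) * n w + (q w * \1_C w) * U (w, Y i w)).
  by apply/funext => w; rewrite /n; ring.
rewrite ExD ?Un ?Uq ?addr0//; first exact: intbleM.
apply: intbleM => //.
under eq_fun do rewrite mulrC.
exact: sqint_indic.
Qed.

End ConditionalIndependence.

(** * Random matrices and centered noise *)

Section RandomMatrices.
Context {R : realType} {dO : measure_display} {Omega : measurableType dO}.
Variable P : probability Omega R.

Definition sqint_mx m n (A : Omega -> 'M[R]_(m, n)) : Prop :=
  forall i j, sqint P (fun w => A w i j).

Lemma sqint_mx_cst m n (A : 'M[R]_(m, n)) : sqint_mx (fun=> A).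
Proof. by move=> i j; exact: sqint_cst. Qed.

Lemma sqint_mxD m n (A B : Omega -> 'M[R]_(m, n)) :
  sqint_mx A -> sqint_mx B -> sqint_mx (fun w => A w + B w).
Proof.
by move=> sA sB i j; under eq_fun do rewrite mxE; exact: sqintD.
Qed.

Lemma sqint_mxZ m n a (A : Omega -> 'M[R]_(m, n)) :
  sqint_mx A -> sqint_mx (fun w => a *: A w).
Proof. by move=> sA i j; under eq_fun do rewrite mxE; exact: sqintZ. Qed.

Lemma sqint_mxB m n (A B : Omega -> 'M[R]_(m, n)) :
  sqint_mx A -> sqint_mx B -> sqint_mx (fun w => A w - B w).
Proof.
move=> sA sB; under eq_fun do rewrite -scaleN1r.
by apply: sqint_mxD => //; exact: sqint_mxZ.
Qed.

Lemma sqint_mxM m n p (M : 'M[R]_(m, n)) (A : Omega -> 'M[R]_(n, p)) :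
  sqint_mx A -> sqint_mx (fun w => M *m A w).
Proof.
move=> sA i j; under eq_fun do rewrite mxE.
by apply: sqint_sum => k; exact: sqintZ.
Qed.

Lemma sqint_mx_rowavg N d (A : Omega -> 'M[R]_(N, d)) :
  sqint_mx A -> sqint_mx (fun w => rowavg (A w)).
Proof.
move=> sA i j; under eq_fun do rewrite /rowavg mxE summxE.
apply: sqintZ; apply: sqint_sum => k; under eq_fun do rewrite mxE.
exact: sA.
Qed.

Lemma intble_dot m n (A B : Omega -> 'M[R]_(m, n)) :
  sqint_mx A -> sqint_mx B -> intble P (fun w => dot (A w) (B w)).
Proof.
move=> sA sB; under eq_fun do rewrite dotE.
by apply: intble_sum => i; apply: intble_sum => j; exact: intbleM.
Qed.

Lemma intble_sqnorm m n (A : Omega -> 'M[R]_(m, n)) :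
  sqint_mx A -> intble P (fun w => sqnorm (A w)).
Proof. by move=> sA; under eq_fun do rewrite sqnorm_dot; exact: intble_dot. Qed.

Lemma intble_qform N d (M : 'M[R]_N) (A : Omega -> 'M[R]_(N, d)) :
  sqint_mx A -> intble P (fun w => qform M (A w)).
Proof.
move=> sA; under eq_fun do rewrite qform_dot.
by apply: intble_dot => //; exact: sqint_mxM.
Qed.

Lemma sqint_mx_le m n (A : Omega -> 'M[R]_(m, n)) (Y : Omega -> R) :
  (forall i j, measurable_fun setT (fun w => A w i j)) -> intble P Y ->
  (forall w, sqnorm (A w) <= Y w) -> sqint_mx A.
Proof.
move=> mA iY AY i j; apply: (sqint_le (mA i j) iY) => w; apply: le_trans (AY w).
rewrite /sqnorm (bigD1 i)//= (bigD1 j)//= -addrA lerDl addr_ge0//.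
  by apply: sumr_ge0 => ? _; exact: sqr_ge0.
by apply: sumr_ge0 => ? _; apply: sumr_ge0 => ? _; exact: sqr_ge0.
Qed.

Lemma Ex_dot_eq0 m n (A B : Omega -> 'M[R]_(m, n)) :
  sqint_mx A -> sqint_mx B ->
  (forall i j, Ex P (fun w => A w i j * B w i j) = 0) ->
  Ex P (fun w => dot (A w) (B w)) = 0.
Proof.
move=> sA sB AB0; under eq_fun do rewrite dotE.
rewrite Ex_sum; last by move=> i; apply: intble_sum => j; exact: intbleM.
rewrite big1// => i _; rewrite Ex_sum; last by move=> j; exact: intbleM.
by rewrite big1// => j _; exact: AB0.
Qed.

Variable G : set (set Omega).
Hypothesis G_sigma : sigma_algebra setT G.
Hypothesis G_meas : G `<=` measurable.

Definition sub_measurable_mx m n (A : Omega -> 'M[R]_(m, n)) : Prop :=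
  forall i j, sub_measurable G (fun w => A w i j).

Lemma sub_measurable_mx_cst m n (A : 'M[R]_(m, n)) : sub_measurable_mx (fun=> A).
Proof. by move=> i j; apply/(sub_measurableP G_sigma); exact: measurable_cst. Qed.

Lemma sub_measurable_mxD m n (A B : Omega -> 'M[R]_(m, n)) :
  sub_measurable_mx A -> sub_measurable_mx B ->
  sub_measurable_mx (fun w => A w + B w).
Proof.
move=> mA mB i j; under eq_fun do rewrite mxE.
by apply/(sub_measurableP G_sigma); apply: measurable_funD;
  exact/(sub_measurableP G_sigma).
Qed.

Lemma sub_measurable_mxZ m n a (A : Omega -> 'M[R]_(m, n)) :
  sub_measurable_mx A -> sub_measurable_mx (fun w => a *: A w).
Proof.
move=> mA i j; under eq_fun do rewrite mxE.
apply/(sub_measurableP G_sigma); apply: measurable_funM; first exact: measurable_cst.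
exact/(sub_measurableP G_sigma).
Qed.

Lemma sub_measurable_mxB m n (A B : Omega -> 'M[R]_(m, n)) :
  sub_measurable_mx A -> sub_measurable_mx B ->
  sub_measurable_mx (fun w => A w - B w).
Proof.
move=> mA mB; under eq_fun do rewrite -scaleN1r.
by apply: sub_measurable_mxD => //; exact: sub_measurable_mxZ.
Qed.

Lemma sub_measurable_mxM m n p (M : 'M[R]_(m, n)) (A : Omega -> 'M[R]_(n, p)) :
  sub_measurable_mx A -> sub_measurable_mx (fun w => M *m A w).
Proof.
move=> mA i j; under eq_fun do rewrite mxE.
apply/(sub_measurableP G_sigma); apply: measurable_sum => k.
apply: measurable_funM; first exact: measurable_cst.
exact/(sub_measurableP G_sigma).
Qed.

Lemma sub_measurable_mx_rowavg N d (A : Omega -> 'M[R]_(N, d)) :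
  sub_measurable_mx A -> sub_measurable_mx (fun w => rowavg (A w)).
Proof.
move=> mA i j; under eq_fun do rewrite /rowavg mxE summxE.
apply/(sub_measurableP G_sigma); apply: measurable_funM; first exact: measurable_cst.
apply: measurable_sum => k; under eq_fun do rewrite mxE.
exact/(sub_measurableP G_sigma).
Qed.

Variables (N d : nat) (n : Omega -> 'M[R]_(N, d)).
Hypothesis n_sqint : sqint_mx n.
Hypothesis n_centered : forall i j A, G A -> Ex P (fun w => n w i j * \1_A w) = 0.

Lemma Ex_dot_noise (A : Omega -> 'M[R]_(N, d)) :
  sub_measurable_mx A -> sqint_mx A -> Ex P (fun w => dot (A w) (n w)) = 0.
Proof.
move=> mA sA; apply: Ex_dot_eq0 => // i j.
by apply: (orthogonal_sub G_sigma G_meas) => //; exact: n_centered.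
Qed.

(** The cross terms are linear in the noise, with coefficients known before the
    noise is drawn. *)
Lemma Ex_qformD_noise (M B : 'M[R]_N) (A : Omega -> 'M[R]_(N, d)) :
  sub_measurable_mx A -> sqint_mx A ->
  Ex P (fun w => qform M (A w + B *m n w)) =
  Ex P (fun w => qform M (A w)) + Ex P (fun w => qform M (B *m n w)).
Proof.
move=> mA sA.
pose C := (M *m B)^T + B^T *m M.
have E w : qform M (A w + B *m n w) =
    (qform M (A w) + qform M (B *m n w)) + dot (C *m A w) (n w).
  rewrite qformD addrAC; congr (_ + _).
  rewrite [C *m _]mulmxDl dotDl; congr (_ + _).
    by rewrite dot_mulmx trmxK mulmxA.
  by rewrite dot_mulmx mulmxA dotC.
under eq_fun do rewrite E.
have sBn := sqint_mxM B n_sqint.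
rewrite ExD; last first.
- by apply: intble_dot => //; exact: sqint_mxM.
- by apply: intbleD; exact: intble_qform.
rewrite ExD; [|exact: intble_qform|exact: intble_qform].
rewrite Ex_dot_noise ?addr0//; first exact: sub_measurable_mxM.
exact: sqint_mxM.
Qed.

Lemma dot_rowavg (a : 'rV[R]_d) (Y : 'M[R]_(N, d)) :
  dot a (rowavg Y) = dot (\matrix_(i < N) (N%:R^-1 *: a)) Y.
Proof.
rewrite /rowavg dotZr dot_sumr mulr_sumr [RHS]dotE; apply: eq_bigr => i _.
rewrite dotE big_ord1 mulr_sumr; apply: eq_bigr => j _.
by rewrite !mxE mulrA.
Qed.

Lemma Ex_sqnormB_noise (a : Omega -> 'rV[R]_d) alpha :
  sub_measurable_mx a -> sqint_mx a ->
  Ex P (fun w => sqnorm (a w - alpha *: rowavg (n w))) =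
  Ex P (fun w => sqnorm (a w)) + alpha ^+ 2 * Ex P (fun w => sqnorm (rowavg (n w))).
Proof.
move=> ma sa.
pose A w : 'M[R]_(N, d) := \matrix_(i < N) (N%:R^-1 *: a w).
have AE w i j : A w i j = N%:R^-1 * a w 0 j by rewrite !mxE.
have sA : sqint_mx A.
  by move=> i j; under eq_fun do rewrite AE; exact: sqintZ.
have mA : sub_measurable_mx A.
  move=> i j; have := sub_measurable_mxZ N%:R^-1 ma 0 j.
  by under eq_fun do rewrite mxE; under [X in _ -> sub_measurable _ X]eq_fun do rewrite AE.
have E w : sqnorm (a w - alpha *: rowavg (n w)) =
    (sqnorm (a w) + alpha ^+ 2 * sqnorm (rowavg (n w))) + (- (2 * alpha)) * dot (A w) (n w).
  by rewrite sqnormB sqnormZ dotZr dot_rowavg; ring.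
under eq_fun do rewrite E.
have ir := intble_sqnorm (sqint_mx_rowavg n_sqint).
have ia := intble_sqnorm sa.
rewrite ExD; [|by apply: intbleD => //; exact: intbleZ|by apply: intbleZ; exact: intble_dot].
rewrite ExD//; last exact: intbleZ.
rewrite ExZ// ExZ; last exact: intble_dot.
by rewrite Ex_dot_noise// mulr0 addr0.
Qed.

(** Only the [N] diagonal terms of the expanded square survive, against the
    factor [N ^- 2] of the squared average. *)
Lemma Ex_sqnorm_rowavg_le (s : R) : (0 < N)%N ->
  (forall i i' j, i != i' -> Ex P (fun w => n w i j * n w i' j) = 0) ->
  (forall i, Ex P (fun w => sqnorm (row i (n w))) <= s) ->
  Ex P (fun w => sqnorm (rowavg (n w))) <= s / N%:R.
Proof.
move=> N0 cross var.
have srow i : sqint_mx (fun w => row i (n w)).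
  by move=> i' j; under eq_fun do rewrite mxE; exact: n_sqint.
have E w : sqnorm (rowavg (n w)) =
    N%:R^-1 ^+ 2 * \sum_i \sum_i' dot (row i (n w)) (row i' (n w)).
  rewrite /rowavg sqnormZ sqnorm_dot dot_suml; congr (_ * _).
  by apply: eq_bigr => i _; rewrite dot_sumr.
under eq_fun do rewrite E.
have idot i i' : intble P (fun w => dot (row i (n w)) (row i' (n w))).
  exact: intble_dot.
rewrite ExZ; last by apply: intble_sum => i; exact: intble_sum.
rewrite Ex_sum; last by move=> i; exact: intble_sum.
have -> : \sum_i Ex P (fun w => \sum_i' dot (row i (n w)) (row i' (n w))) =
    \sum_i Ex P (fun w => sqnorm (row i (n w))).
  apply: eq_bigr => i _; rewrite Ex_sum// (bigD1 i)//= [X in _ + X]big1 ?addr0.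
    by congr Ex; apply/funext => w; rewrite sqnorm_dot.
  move=> i' ii'; apply: Ex_dot_eq0 => // k j.
  rewrite -[RHS](cross i i' j) 1?eq_sym//.
  by congr Ex; apply/funext => w; rewrite !mxE.
have sumv : \sum_i Ex P (fun w => sqnorm (row i (n w))) <= N%:R * s.
  apply: (@le_trans _ _ (\sum_(i < N) s)); first exact: ler_sum.
  by rewrite sumr_const card_ord mulr_natl.
have N0' : 0 < N%:R :> R by rewrite ltr0n.
apply: le_trans (ler_wpM2l (sqr_ge0 _) sumv) _.
rewrite le_eqVlt; apply/orP; left; apply/eqP; field.
by rewrite gt_eqF.
Qed.

End RandomMatrices.

(** * Combining the two recursions *)

(** The weights 8 / 3 and 40 make the right-hand side telescope; the stepsize
    bound leaves enough room for each recursion to absorb the error term that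
    the other one produces. *)
Lemma combine_recursions (R : realType) (L N0 delta Q alpha s2 D C X X' V V' M : R) :
  0 < L -> 0 < N0 -> 0 < delta -> 0 < alpha -> 0 <= D -> 0 <= C ->
  alpha * L <= 100^-1 -> alpha ^+ 2 * Q <= delta ^+ 2 / (480 * L ^+ 2) ->
  0 <= Q ->
  V' <= V - delta / 2 * C + 4 / delta * alpha ^+ 2 * Q * M
        + alpha ^+ 2 * Q * (N0 * s2) ->
  M <= 2 * L ^+ 2 * C + 4 * L * N0 * D ->
  X' <= X - (2 * alpha - 4 * alpha ^+ 2 * L) * D
        + (alpha + 2 * alpha ^+ 2 * L) * (L / N0 * C) + alpha ^+ 2 * (s2 / N0) ->
  D + L / N0 * C <= 8 / (3 * alpha) * (X - X') + 40 * L / delta * (N0^-1 * (V - V'))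
    + (8 * alpha * s2 / (3 * N0) + 40 * alpha ^+ 2 * Q * L * s2 / delta).
Proof.
move=> L0 N00 d0 a0 D0 C0 aL aQ Q0 hV hM hX.
set c := L / N0 * C.
have c0 : 0 <= c by rewrite mulr_ge0 ?divr_ge0 ?(ltW L0) ?(ltW N00).
have avg : (196 / 100) * D - (102 / 100) * c <= alpha^-1 * (X - X') + alpha * (s2 / N0).
  have hX' : alpha * ((2 - 4 * (alpha * L)) * D - (1 + 2 * (alpha * L)) * c) <=
      alpha * (alpha^-1 * (X - X') + alpha * (s2 / N0)).
    rewrite [leRHS]mulrDr mulVKf ?gt_eqF//.
    by move: hX; rewrite -/c; lra.
  rewrite ler_pM2l// in hX'; apply: le_trans hX'.
  have h1 : alpha * L * D <= 100^-1 * D by rewrite ler_wpM2r.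
  have h2 : alpha * L * c <= 100^-1 * c by rewrite ler_wpM2r.
  lra.
have net : (29 / 60) * c - 30^-1 * D <=
    L / delta * (N0^-1 * (V - V')) + L / delta * (alpha ^+ 2 * Q * s2).
  have M1 : L / delta * (N0^-1 * (4 / delta * (alpha ^+ 2 * Q) * M)) <= 60^-1 * c + 30^-1 * D.
    apply: (@le_trans _ _ (L / delta * (N0^-1 * (4 / delta * (delta ^+ 2 / (480 * L ^+ 2)) *
        (2 * L ^+ 2 * C + 4 * L * N0 * D))))).
      rewrite ler_pM2l ?divr_gt0// ler_pM2l ?invr_gt0//.
      apply: le_trans (ler_wpM2l _ hM) _.
        by rewrite mulr_ge0 ?divr_ge0 ?(ltW d0)// mulr_ge0 ?sqr_ge0.
      rewrite ler_wpM2r// ?ler_pM2l ?divr_gt0//.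
      by rewrite addr_ge0// mulr_ge0// mulr_ge0 ?sqr_ge0 ?ltW// mulr_gt0.
    rewrite le_eqVlt; apply/orP; left; apply/eqP; rewrite /c.
    by field; rewrite !gt_eqF.
  have hV' : L / delta * (N0^-1 * (delta / 2 * C)) <=
      L / delta * (N0^-1 * (V - V' + 4 / delta * (alpha ^+ 2 * Q) * M
        + alpha ^+ 2 * Q * (N0 * s2))).
    by rewrite ler_pM2l ?divr_gt0// ler_pM2l ?invr_gt0//; move: hV; rewrite !mulrA; lra.
  have e1 : L / delta * (N0^-1 * (delta / 2 * C)) = c / 2.
    by rewrite /c; field; rewrite !gt_eqF.
  have e2 : L / delta * (N0^-1 * (alpha ^+ 2 * Q * (N0 * s2))) =
      L / delta * (alpha ^+ 2 * Q * s2).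
    by field; rewrite !gt_eqF.
  rewrite e1 !mulrDr e2 in hV'; rewrite mulrBr mulrBr in M1 hV' *.
  by move: M1 hV'; lra.
have -> : 8 / (3 * alpha) * (X - X') + 40 * L / delta * (N0^-1 * (V - V')) +
    (8 * alpha * s2 / (3 * N0) + 40 * alpha ^+ 2 * Q * L * s2 / delta) =
    8 / 3 * (alpha^-1 * (X - X') + alpha * (s2 / N0)) +
    40 * (L / delta * (N0^-1 * (V - V')) + L / delta * (alpha ^+ 2 * Q * s2)).
  by field; rewrite !gt_eqF.
lra.
Qed.

Lemma sum_telescope_le (R : realType) (a b c : R) (u X V : nat -> R) K :
  (forall k, u k <= a * (X k - X k.+1) + b * (V k - V k.+1) + c) ->
  \sum_(k < K) u k <= a * (X 0%N - X K) + b * (V 0%N - V K) + K%:R * c.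
Proof.
move=> step; elim: K => [|K IHK]; first by rewrite big_ord0 !subrr !mulr0 mul0r !addr0.
by rewrite big_ord_recr/=; have := step K; rewrite -natr1; lra.
Qed.

Section GradientTracking.
Variables (R : realType) (N d : nat).
Hypothesis N_gt0 : (0 < N)%N.
Context {dO : measure_display} {Omega : measurableType dO}.
Variable P : probability Omega R.
Context {dX : measure_display}.
Variables (Xi : 'I_N -> measurableType dX) (F : forall i, 'rV[R]_d -> Xi i -> R).
Variable f : 'I_N -> 'rV[R]_d -> R.
Hypothesis F_diff : forall i (s : Xi i) x, differentiable (fun u => F u s) x.
Hypothesis F_meas : forall i x, measurable_fun setT (F x : Xi i -> R).
Hypothesis f_diff : forall i x, differentiable (f i) x.
Variable L : R.
Hypothesis L_gt0 : 0 < L.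
Hypothesis f_convex : forall i, convex_function [set: 'rV[R]_d] (f i).
Hypothesis f_smooth : forall i, smooth L (f i).
Variable xstar : 'rV[R]_d.
Hypothesis xstar_min : forall x, favg f xstar <= favg f x.
Variables (W : nat -> 'M[R]_N) (tau : nat) (lam : R).
Hypotheses (tau_gt0 : (0 < tau)%N) (lam_ge0 : 0 <= lam) (lam_lt1 : lam < 1).
Hypothesis W_network : network_assumption W tau lam.
Variables (alpha : R) (x0 : 'M[R]_(N, d)).
Hypothesis alpha_gt0 : 0 < alpha.
Variable xi : nat -> forall i : 'I_N, {mfun Omega >-> Xi i}.
Variables (Fk : nat -> set (set Omega)) (sigma : R).
Hypothesis noise : noise_assumption F f W alpha x0 P xi Fk sigma.

Local Notation Pi := (avg_mx R N).
Local Notation Wt k := (W k - Pi).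
Local Notation delta := (delta_cst tau lam).
Local Notation eta := (eta_cst tau lam).
Local Notation Q := (Q_cst tau lam).
Local Notation q k := (qform (lyap_mx W tau lam k)).
Local Notation x := (xit F W alpha x0 xi).
Local Notation g := (git F W alpha x0 xi).
Local Notation z := (zit F f W alpha x0 xi tau lam xstar).
Local Notation y := (ytilde F f W alpha x0 xi xstar).

Let sg k w := stoch_grad F (x k w) (samples xi w k).
Let fg k w := full_grad f (x k w).
Let fgs : 'M[R]_(N, d) := full_grad f (\matrix_(i < N) xstar).
Let drift k w := fg k w - fgs.
Let n k w := sg k w - fg k w.

(** * Pathwise recursions *)

Let dW k : doubly_stochastic (W k). Proof. by have [] := W_network. Qed.

Lemma xitS k w : x k.+1 w = W k *m (x k w - alpha *: g k w).
Proof. by rewrite /xit /git /=; case: (sgt _ _ _ _ _ _). Qed.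

Lemma gitS k w : g k.+1 w = W k *m g k w + sg k.+1 w - sg k w.
Proof. by rewrite /sg /xit /git /=; case: (sgt _ _ _ _ _ _). Qed.

Lemma git0 w : g 0%N w = sg 0%N w. Proof. by []. Qed.

Lemma yE k w : y k w = g k w - sg k w + fgs. Proof. by []. Qed.

Lemma ytilde0 w : y 0%N w = fgs.
Proof. by rewrite yE git0 subrr add0r. Qed.

Lemma ytildeS k w : y k.+1 w = W k *m g k w - sg k w + fgs.
Proof.
have cancel (A B C : 'M[R]_(N, d)) : A + B - C - B + fgs = A - C + fgs.
  by rewrite [A + B - C]addrAC addrK.
by rewrite yE gitS cancel.
Qed.

Lemma gitE k w : g k w = y k w + drift k w + n k w.
Proof.
have regroup (A B C D : 'M[R]_(N, d)) : A = A - B + D + (C - D) + (B - C).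
  by apply/matrixP => i j; rewrite !mxE; ring.
exact: regroup.
Qed.

(** Mixing preserves the mean and the gradient corrections telescope. *)
Lemma rowavg_git k w : rowavg (g k w) = rowavg (sg k w).
Proof.
elim: k => [|k IHk] //.
have cancel (a b : 'rV[R]_d) : a + b - a = b by rewrite addrAC subrr add0r.
by rewrite gitS rowavgB rowavgD rowavg_mul// IHk cancel.
Qed.

(** The initial trackers and the optimality of [xstar] place [ytilde] in the
    disagreement space, where [W k] acts as [W k - Pi]. *)
Lemma avg_ytilde k w : Pi *m y k w = 0.
Proof.
rewrite avg_mxE yE rowavgD rowavgB rowavg_git subrr add0r.
have -> : rowavg fgs = 0 by exact: rowavg_full_grad_consensus f_diff L_gt0 f_smooth _ xstar_min.
by apply/row_matrixP => i; rewrite rowK row0.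
Qed.

Lemma rowavg_xitS k w :
  rowavg (x k.+1 w) = rowavg (x k w) - alpha *: rowavg (fg k w)
                      - alpha *: rowavg (n k w).
Proof.
rewrite xitS rowavg_mul// rowavgB rowavgZ rowavg_git /n rowavgB.
by rewrite -addrA -opprD -scalerDr [rowavg (fg k w) + _]addrC subrK.
Qed.

Let eta_neq0 : eta != 0.
Proof. by rewrite gt_eqF// eta_gt0. Qed.

Lemma Wt_mul_centered k (X : 'M[R]_(N, d)) : Wt k *m centered X = Wt k *m X.
Proof.
have WtPi : Wt k *m Pi = 0.
  by rewrite mulmxBl mul_doubly_stochastic_avg// avg_mx_idem// subrr.
by rewrite /centered mulmxA mulmxBr mulmx1 WtPi subr0.
Qed.

Lemma centered_xitS k w :
  centered (x k.+1 w) =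
  Wt k *m (centered (x k w) - eta *: z k w - alpha *: drift k w)
  + (- alpha *: Wt k) *m n k w.
Proof.
have -> : centered (x k.+1 w) = Wt k *m (x k w - alpha *: g k w).
  by rewrite xitS /centered mulmxA mulmxBl mul1mx mul_avg_doubly_stochastic.
have -> : eta *: z k w = alpha *: y k w.
  by rewrite /zit scalerA mulrC divfK.
have split_step (A B C D : 'M[R]_(N, d)) :
    A - alpha *: (B + C + D) = A - alpha *: B - alpha *: C - alpha *: D.
  by apply/matrixP => i j; rewrite !mxE; ring.
rewrite gitE split_step [LHS]mulmxBr -scalemxAr -scalemxAl scaleNr.
by congr (_ - _); rewrite !mulmxBr Wt_mul_centered.
Qed.

Lemma zitS k w :
  z k.+1 w =
  (Wt k *m z k w - (alpha / eta) *: ((1%:M - W k) *m drift k w))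
  + (- (alpha / eta) *: (1%:M - W k)) *m n k w.
Proof.
have yS : y k.+1 w = Wt k *m y k w - (1%:M - W k) *m drift k w
    - (1%:M - W k) *m n k w.
  have regroup (A : 'M[R]_N) (Y D n' t : 'M[R]_(N, d)) :
      A *m (Y + D + n') - (n' + D + t) + t =
      A *m Y - (1%:M - A) *m D - (1%:M - A) *m n'.
    rewrite 2!mulmxDr 2!(mulmxBl 1%:M) 2!mul1mx.
    move: (A *m Y) (A *m D) (A *m n') => a b c.
    by apply/matrixP => i j; rewrite !mxE; ring.
  have sgE' : sg k w = n k w + drift k w + fgs by rewrite /n /drift addrA !subrK.
  by rewrite ytildeS gitE sgE' regroup [Wt k *m _]mulmxBl avg_ytilde subr0.
rewrite -[(- _ *: _) *m _]scalemxAl scaleNr /zit yS -scalemxAr.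
by rewrite [LHS]scalerBr [X in X - _ = _]scalerBr.
Qed.

(** * Measurability and integrability *)

Let Fs k := info_sigma_algebra noise k.
Let Fm k := @info_measurable _ _ _ _ _ _ _ _ _ _ _ _ _ _ _ _ noise k.

Lemma sub_xit_lt k l : (l < k)%N -> sub_measurable_mx (Fk k) (x l).
Proof. by move=> lk i j; have [] := info_iterates noise i j lk. Qed.

Lemma sub_git_lt k l : (l < k)%N -> sub_measurable_mx (Fk k) (g l).
Proof. by move=> lk i j; have [] := info_iterates noise i j lk. Qed.

(** Past stochastic gradients are recovered from the past trackers by solving
    the tracker recursion for them. *)
Lemma sub_sg_lt k l : (l < k)%N -> sub_measurable_mx (Fk k) (sg l).
Proof.
elim: l => [|l IHl] lk.
  by have := sub_git_lt lk; rewrite (_ : g 0%N = sg 0%N)//; apply/funext.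
have -> : sg l.+1 = fun w => g l.+1 w - W l *m g l w + sg l w.
  by apply/funext => w; rewrite gitS; apply/matrixP => i j; rewrite !mxE; ring.
have lk' := ltnW lk.
apply: (sub_measurable_mxD (Fs k)); last exact: IHl.
apply: (sub_measurable_mxB (Fs k)); first exact: sub_git_lt.
by apply: (sub_measurable_mxM (Fs k)); exact: sub_git_lt.
Qed.

Lemma sub_xit k : sub_measurable_mx (Fk k) (x k).
Proof.
case: k => [|k]; first exact: (sub_measurable_mx_cst (Fs 0)).
rewrite (funext (xitS k)).
apply: (sub_measurable_mxM (Fs _)); apply: (sub_measurable_mxB (Fs _)).
  exact: sub_xit_lt.
by apply: (sub_measurable_mxZ (Fs _)); exact: sub_git_lt.
Qed.

(** The tracker [g k] depends on the samples of iteration [k], but only through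
    the gradient subtracted in [ytilde]. *)
Lemma sub_zit k : sub_measurable_mx (Fk k) (z k).
Proof.
apply: (sub_measurable_mxZ (Fs _)); case: k => [|k].
  rewrite (funext ytilde0).
  exact: (sub_measurable_mx_cst (Fs 0)).
rewrite (funext (ytildeS k)).
apply: (sub_measurable_mxD (Fs _)); last exact: (sub_measurable_mx_cst (Fs _)).
apply: (sub_measurable_mxB (Fs _)); last exact: sub_sg_lt.
by apply: (sub_measurable_mxM (Fs _)); exact: sub_git_lt.
Qed.

Lemma sub_fg k : sub_measurable_mx (Fk k) (fg k).
Proof.
move=> i j; apply/(sub_measurableP (Fs k)).
under eq_fun do rewrite mxE.
apply: (@measurable_grad _ _ _ (g_sigma_algebraType (Fk k)) (g_sigma_algebraType (Fk k))
  d (fun u _ => f i u) (fun w => row i (x k w)) (fun w => w)) => //.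
- move=> j'; under eq_fun do rewrite mxE.
  by apply/(sub_measurableP (Fs k)); exact: sub_xit.
Qed.

Lemma grad_noiseE k i j w : grad_noise F f W alpha x0 xi k i w 0 j = n k w i j.
Proof. by rewrite /grad_noise mxE. Qed.

Lemma sqint_noise k : sqint_mx P (n k).
Proof.
move=> i j; have [v [[iv _ _ _] _]] := noise_variance noise k i.
have [iu _ _ _] := noise_unbiased noise k i j.
apply: (sqint_le _ iv).
  by have := intble_measurable iu; under eq_fun do rewrite grad_noiseE.
move=> w; rewrite -grad_noiseE /sqnorm big_ord1 (bigD1 j)//= lerDl.
by apply: sumr_ge0 => ? _; exact: sqr_ge0.
Qed.

Lemma noise_centered k i j A : Fk k A -> Ex P (fun w => n k w i j * \1_A w) = 0.
Proof.
move=> FA; have h := noise_unbiased noise k i j.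
have := is_cond_exp_Ex h FA; under eq_fun do rewrite grad_noiseE.
move=> ->; rewrite -[RHS](Ex_cst P 0); congr Ex; apply/funext => w.
by rewrite /= mul0r.
Qed.

Lemma Ex_noise_row k i : Ex P (fun w => sqnorm (row i (n k w))) <= sigma ^+ 2.
Proof.
have [v [hv vs]] := noise_variance noise k i.
have FT : Fk k setT by have [h0 hC _] := Fs k; have := hC _ h0; rewrite setD0.
have := is_cond_exp_Ex hv FT.
under eq_fun do rewrite indicE in_setT mulr1.
under [in X in _ = X -> _]eq_fun do rewrite indicE in_setT mulr1.
move=> E; rewrite (_ : Ex P (fun w => sqnorm _) = Ex P v)//.
have [_ iv mv _] := hv.
rewrite -(Ex_cst P (sigma ^+ 2)) -subr_ge0.
rewrite -ExB//; last exact: intble_cst.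
have mv' := sub_measurable_fun (@Fm k) mv.
(* The bound on v holds almost surely only: pass to the positive part. *)
rewrite (Ex_ae_eq (Y := fun w => Num.max 0 (sigma ^+ 2 - v w))).
- by apply: Ex_ge0 => w; rewrite le_max lexx.
- by apply: measurable_funB => //; exact: measurable_cst.
- apply: measurable_maxr; first exact: measurable_cst.
  by apply: measurable_funB => //; exact: measurable_cst.
- by apply: filterS vs => w vw; rewrite max_r// subr_ge0.
Qed.

(** The noise of an agent is a measurable function of the past and of its own
    sample, so that conditional independence applies to it. *)
Lemma noise_cross k i i' j : i != i' -> Ex P (fun w => n k w i j * n k w i' j) = 0.
Proof.
move=> ii'.
pose U l (p : g_sigma_algebraType (Fk k) * Xi l) : R :=
  grad (fun u => F u p.2) (row l (x k p.1)) 0 j - grad (f l) (row l (x k p.1)) 0 j.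
have UE l w : U l (w, xi k l w) = n k w l j by rewrite /U /n /sg /fg !mxE.
have mrow l j' : measurable_fun setT
    (fun p : g_sigma_algebraType (Fk k) * Xi l => row l (x k p.1) 0 j').
  under eq_fun do rewrite mxE.
  apply: (@measurableT_comp _ _ _ _ _ _ (fun w : g_sigma_algebraType (Fk k) => x k w l j') _ fst) => //.
  by apply/(sub_measurableP (Fs k)); exact: sub_xit.
have mU l : measurable_fun setT (U l).
  apply: measurable_funB.
    by apply: (@measurable_grad _ _ _ _ _ d (fun u s => F u s)
      (fun p : g_sigma_algebraType (Fk k) * Xi l => row l (x k p.1)) snd);
      [exact: F_meas|move=> s u; exact: F_diff|exact: mrow|exact: measurable_snd].
  by apply: (@measurable_grad _ _ _ _ _ d (fun u (_ : Xi l) => f l u)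
      (fun p : g_sigma_algebraType (Fk k) * Xi l => row l (x k p.1)) snd);
      [move=> u; exact: measurable_cst|move=> s u; exact: f_diff|exact: mrow|exact: measurable_snd].
have UEf l : (fun w => U l (w, xi k l w)) = (fun w => n k w l j).
  by apply/funext => w; exact: UE.
have := @cond_independent_orthogonal _ _ _ P (Fk k) (Fs k) (@Fm k) _ _ Xi
  (fun i => xi k i) (fun i => measurable_funPT (xi k i))
  (samples_independent noise k) i i' ii' (U i) (U i') (mU i) (mU i').
rewrite !UEf => /(_ (sqint_noise k i j) (sqint_noise k i' j)) h.
rewrite -[RHS]h; first by congr Ex; apply/funext => w; rewrite !UE.
by move=> C FC; under eq_fun do rewrite UE; exact: noise_centered.
Qed.

Lemma measurable_mx_sub k m p (A : Omega -> 'M[R]_(m, p)) i j :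
  sub_measurable_mx (Fk k) A -> measurable_fun setT (fun w => A w i j).
Proof. by move=> mA; exact: (sub_measurable_fun (@Fm k) (mA i j)). Qed.

Lemma sqint_fg k : sqint_mx P (x k) -> sqint_mx P (fg k).
Proof.
move=> sx.
apply: (@sqint_mx_le _ _ _ P _ _ _ (fun w => \sum_i
   (2 * (L ^+ 2 * sqnorm (row i (x k w))) + 2 * sqnorm (grad (f i) 0)))).
- by move=> i j; apply: measurable_mx_sub; exact: sub_fg.
- apply: intble_sum => i; apply: intbleD; last exact: intble_cst.
  apply: intbleZ; apply: intbleZ; apply: intble_sqnorm => i' j.
  by under eq_fun do rewrite mxE; exact: sx.
- move=> w; rewrite sqnorm_rows; apply: ler_sum => i _; rewrite rowK.
  rewrite -[grad _ _](subrK (grad (f i) 0)).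
  apply: le_trans (sqnormD_le _ _) _; rewrite lerD2r ler_pM2l//.
  have := f_smooth i (row i (x k w)) 0; rewrite subr0.
  exact: l2norm_le_sqr (ltW L_gt0).
Qed.

Lemma sgE k w : sg k w = fg k w + n k w.
Proof. by rewrite /n addrC subrK. Qed.

Lemma sqint_xg k : sqint_mx P (x k) /\ sqint_mx P (g k).
Proof.
have sqint_sg l : sqint_mx P (x l) -> sqint_mx P (sg l).
  move=> sx; rewrite (funext (sgE l)).
  by apply: sqint_mxD; [exact: sqint_fg|exact: sqint_noise].
elim: k => [|k [sx sgk]].
  have sx : sqint_mx P (x 0%N) by exact: sqint_mx_cst.
  by split=> //; exact: sqint_sg.
have sxS : sqint_mx P (x k.+1).
  rewrite (funext (xitS k)).
  by apply: sqint_mxM; apply: sqint_mxB => //; exact: sqint_mxZ.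
split=> //; rewrite (funext (gitS k)).
apply: sqint_mxB; last exact: sqint_sg.
by apply: sqint_mxD; [exact: sqint_mxM|exact: sqint_sg].
Qed.

Lemma sqint_xit k : sqint_mx P (x k). Proof. by case: (sqint_xg k). Qed.

Lemma sqint_drift k : sqint_mx P (drift k).
Proof. by apply: sqint_mxB; [exact/sqint_fg/sqint_xit|exact: sqint_mx_cst]. Qed.

Lemma sqint_zit k : sqint_mx P (z k).
Proof.
apply: sqint_mxZ.
have -> : y k = fun w => g k w - n k w - drift k w.
  by apply/funext => w; rewrite gitE !addrK.
case: (sqint_xg k) => _ sgk.
apply: sqint_mxB; last exact: sqint_drift.
by apply: sqint_mxB => //; exact: sqint_noise.
Qed.

Lemma sqint_centered k : sqint_mx P (fun w => centered (x k w)).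
Proof. exact/sqint_mxM/sqint_xit. Qed.

Let gap k w := favg f (rowavg (x k w)) - favg f xstar.

(** The gap lies between 0 and the quadratic bound based at [xstar], whose
    linear part vanishes by optimality. *)
Lemma intble_gap k : intble P (gap k).
Proof.
have srow : sqint_mx P (fun w => rowavg (x k w) - xstar).
  by apply: sqint_mxB; [exact/sqint_mx_rowavg/sqint_xit|exact: sqint_mx_cst].
apply: (@intble_le _ _ _ _ _ (fun w => L / 2 * sqnorm (rowavg (x k w) - xstar))).
- apply: measurable_funB; last exact: measurable_cst.
  apply: measurable_funM; first exact: measurable_cst.
  apply: measurable_sum => i.
  apply: (@measurable_caratheodory _ _ _ _ _ d (fun u (_ : Omega) => f i u) _
     (fun w => rowavg (x k w)) id).
  + by move=> u; exact: measurable_cst.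
  + by move=> j; exact: (sqint_measurable (sqint_mx_rowavg (sqint_xit k) 0 j)).
  + exact: measurable_id.
  + by move=> _ u; exact: differentiable_continuous.
- by apply: intbleZ; exact: intble_sqnorm.
move=> w; rewrite ger0_norm; last exact: favg_gap_ge0.
apply: le_trans (ler_norm _).
have N0 : 0 < N%:R :> R by rewrite ltr0n.
rewrite -(ler_pM2l N0) favg_gapE//.
apply: (@le_trans _ _ (\sum_i (dot (grad (f i) xstar) (rowavg (x k w) - xstar) +
   L / 2 * sqnorm (rowavg (x k w) - xstar)))).
  apply: ler_sum => i _; rewrite lerBlDl addrA; exact: smooth_descent.
rewrite big_split/= -dot_suml (favg_grad_min N_gt0 f_diff L_gt0 f_smooth xstar_min) dot0l add0r.
by rewrite sumr_const card_ord mulr_natl.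
Qed.

(** * Recursions in expectation *)

Let X_ k := Ex P (fun w => sqnorm (rowavg (x k w) - xstar)).
Let V_ k := Ex P (fun w => q k (centered (x k w)) + 2 * q k (z k w)).
Let C_ k := Ex P (fun w => sqnorm (centered (x k w))).
Let D_ k := Ex P (gap k).

Lemma intble_lyap k : intble P (fun w => q k (centered (x k w)) + 2 * q k (z k w)).
Proof.
apply: intbleD; first exact/intble_qform/sqint_centered.
exact/intbleZ/intble_qform/sqint_zit.
Qed.

Lemma Ex_noise_le k : Ex P (fun w => sqnorm (n k w)) <= N%:R * sigma ^+ 2.
Proof.
under eq_fun do rewrite sqnorm_rows.
rewrite Ex_sum; last first.
  move=> i; apply: intble_sqnorm => i' j; under eq_fun do rewrite mxE.
  exact: sqint_noise.
apply: (@le_trans _ _ (\sum_(i < N) sigma ^+ 2)).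
  by apply: ler_sum => i _; exact: Ex_noise_row.
by rewrite sumr_const card_ord mulr_natl.
Qed.

(** Conditionally on the past the noise separates from the drift, and the two
    pathwise estimates apply to each part. *)
Lemma lyap_recursion k :
  V_ k.+1 <= V_ k - delta / 2 * C_ k
    + 4 / delta * alpha ^+ 2 * Q * Ex P (fun w => sqnorm (drift k w))
    + alpha ^+ 2 * Q * (N%:R * sigma ^+ 2).
Proof.
pose a w := Wt k *m (centered (x k w) - eta *: z k w - alpha *: drift k w).
pose b w := Wt k *m z k w - (alpha / eta) *: ((1%:M - W k) *m drift k w).
pose A := - alpha *: Wt k; pose B := - (alpha / eta) *: (1%:M - W k).
have sd := sqint_drift k; have sz := sqint_zit k; have sc := sqint_centered k.
have sn := sqint_noise k.
have sa : sqint_mx P a.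
  apply: sqint_mxM; apply: sqint_mxB; last exact: sqint_mxZ.
  by apply: sqint_mxB => //; exact: sqint_mxZ.
have sb : sqint_mx P b.
  apply: sqint_mxB; first exact: sqint_mxM.
  by apply: sqint_mxZ; exact: sqint_mxM.
have md : sub_measurable_mx (Fk k) (drift k).
  by apply: (sub_measurable_mxB (Fs k)); [exact: sub_fg|exact: (sub_measurable_mx_cst (Fs k))].
have mz := @sub_zit k.
have ma : sub_measurable_mx (Fk k) a.
  apply: (sub_measurable_mxM (Fs k)).
  apply: (sub_measurable_mxB (Fs k)); last exact: (sub_measurable_mxZ (Fs k)).
  apply: (sub_measurable_mxB (Fs k)); last exact: (sub_measurable_mxZ (Fs k)).
  by apply: (sub_measurable_mxM (Fs k)); exact: sub_xit.
have mb : sub_measurable_mx (Fk k) b.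
  apply: (sub_measurable_mxB (Fs k)); first exact: (sub_measurable_mxM (Fs k)).
  by apply: (sub_measurable_mxZ (Fs k)); exact: (sub_measurable_mxM (Fs k)).
have nc := @noise_centered k.
have -> : V_ k.+1 = Ex P (fun w => q k.+1 (a w) + 2 * q k.+1 (b w)) +
    Ex P (fun w => q k.+1 (A *m n k w) + 2 * q k.+1 (B *m n k w)).
  have iq (M : Omega -> 'M[R]_(N, d)) : sqint_mx P M -> intble P (fun w => q k.+1 (M w)).
    exact: intble_qform.
  have iAn := iq _ (sqint_mxM A sn); have iBn := iq _ (sqint_mxM B sn).
  have iaA := iq _ (sqint_mxD sa (sqint_mxM A sn)).
  have ibB := iq _ (sqint_mxD sb (sqint_mxM B sn)).
  have ia := iq _ sa; have ib := iq _ sb.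
  rewrite (ExD ia (intbleZ 2 ib)) (ExD iAn (intbleZ 2 iBn)) (ExZ 2 ib) (ExZ 2 iBn).
  have -> : V_ k.+1 = Ex P (fun w => q k.+1 (a w + A *m n k w) +
      2 * q k.+1 (b w + B *m n k w)).
    by congr Ex; apply/funext => w; rewrite centered_xitS zitS.
  rewrite (ExD iaA (intbleZ 2 ibB)) (ExZ 2 ibB).
  have -> := Ex_qformD_noise (Fs k) (@Fm k) sn nc (lyap_mx W tau lam k.+1) A ma sa.
  have -> := Ex_qformD_noise (Fs k) (@Fm k) sn nc (lyap_mx W tau lam k.+1) B mb sb.
  by rewrite mulrDr addrACA.
apply: lerD.
  have ->: V_ k - delta / 2 * C_ k +
      4 / delta * alpha ^+ 2 * Q * Ex P (fun w => sqnorm (drift k w)) =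
    Ex P (fun w => (q k (centered (x k w)) + 2 * q k (z k w)
      - delta / 2 * sqnorm (centered (x k w)))
      + 4 / delta * alpha ^+ 2 * Q * sqnorm (drift k w)).
    have i1 := intble_lyap k; have i2 := intble_sqnorm sc; have i3 := intble_sqnorm sd.
    rewrite ExD; [|by apply: intbleB => //; exact: intbleZ|exact: intbleZ].
    rewrite ExB//; last exact: intbleZ.
    by rewrite !ExZ.
  apply: Ex_le.
  - by apply: intbleD; [|apply: intbleZ]; exact: intble_qform.
  - apply: intbleD; last by apply: intbleZ; exact: intble_sqnorm.
    apply: intbleB; first exact: intble_lyap.
    by apply: intbleZ; exact: intble_sqnorm.
  - by move=> w; exact: lyap_step_drift.
apply: (@le_trans _ _ (Ex P (fun w => alpha ^+ 2 * Q * sqnorm (n k w)))).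
  apply: Ex_le.
  - by apply: intbleD; [|apply: intbleZ]; apply: intble_qform; exact: sqint_mxM.
  - by apply: intbleZ; exact: intble_sqnorm.
  - by move=> w; rewrite /A /B -!scalemxAl; exact: lyap_step_noise.
rewrite ExZ; last exact: intble_sqnorm.
rewrite ler_wpM2l//; last exact: Ex_noise_le.
by rewrite mulr_ge0 ?sqr_ge0//; have := Q_ge33 tau_gt0 lam_ge0 lam_lt1; lra.
Qed.

Lemma drift_le k : Ex P (fun w => sqnorm (drift k w)) <=
  2 * L ^+ 2 * C_ k + 4 * L * N%:R * D_ k.
Proof.
have i1 := intble_sqnorm (sqint_centered k); have i2 := intble_gap k.
rewrite /C_ /D_ -!ExZ// -ExD; [|exact: intbleZ|exact: intbleZ].
apply: Ex_le; first exact/intble_sqnorm/sqint_drift.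
  by apply: intbleD; exact: intbleZ.
by move=> w; exact: full_grad_diff_le.
Qed.

Lemma avg_recursion k :
  X_ k.+1 <= X_ k - (2 * alpha - 4 * alpha ^+ 2 * L) * D_ k
    + (alpha + 2 * alpha ^+ 2 * L) * (L / N%:R * C_ k)
    + alpha ^+ 2 * (sigma ^+ 2 / N%:R).
Proof.
pose a w := rowavg (x k w) - alpha *: rowavg (fg k w) - xstar.
have sa : sqint_mx P a.
  apply: sqint_mxB; last exact: sqint_mx_cst.
  apply: sqint_mxB; first exact/sqint_mx_rowavg/sqint_xit.
  exact/sqint_mxZ/sqint_mx_rowavg/sqint_fg/sqint_xit.
have ma : sub_measurable_mx (Fk k) a.
  apply: (sub_measurable_mxB (Fs k)); last exact: (sub_measurable_mx_cst (Fs k)).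
  apply: (sub_measurable_mxB (Fs k)).
    by apply: (sub_measurable_mx_rowavg (Fs k)); exact: sub_xit.
  apply: (sub_measurable_mxZ (Fs k)); apply: (sub_measurable_mx_rowavg (Fs k)).
  exact: sub_fg.
have -> : X_ k.+1 = Ex P (fun w => sqnorm (a w - alpha *: rowavg (n k w))).
  by congr Ex; apply/funext => w; rewrite rowavg_xitS [in RHS]addrAC.
rewrite (Ex_sqnormB_noise (Fs k) (@Fm k) (sqint_noise k) (@noise_centered k) alpha ma sa).
apply: lerD; last first.
  rewrite ler_wpM2l ?sqr_ge0//; apply: Ex_sqnorm_rowavg_le => //.
  - exact: sqint_noise.
  - exact: noise_cross.
  - exact: Ex_noise_row.
have i1 := intble_sqnorm (sqint_centered k); have i2 := intble_gap k.
have i3 : intble P (fun w => sqnorm (rowavg (x k w) - xstar)).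
  apply: intble_sqnorm; apply: sqint_mxB; last exact: sqint_mx_cst.
  exact/sqint_mx_rowavg/sqint_xit.
rewrite /C_ /D_ /X_ -!ExZ//; last exact: intbleZ.
have i4 := intbleZ (2 * alpha - 4 * alpha ^+ 2 * L) i2.
have i5 := intbleZ (alpha + 2 * alpha ^+ 2 * L) (intbleZ (L / N%:R) i1).
rewrite -ExB// -ExD//; last exact: intbleB.
apply: Ex_le; first exact: intble_sqnorm.
  by apply: intbleD => //; exact: intbleB.
by move=> w; apply: avg_step_drift => //; exact: ltW.
Qed.

Hypothesis alpha_le : alpha <= delta / (Num.sqrt 480 * L * Num.sqrt Q).

Let delta_pos : 0 < delta. Proof. exact: delta_gt0. Qed.

Let Q_big : 33 <= Q. Proof. exact: Q_ge33. Qed.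

Lemma stepsize_sqr : alpha ^+ 2 * Q <= delta ^+ 2 / (480 * L ^+ 2).
Proof.
have Q0 : 0 < Q by have := Q_big; lra.
have p480 : 0 < 480%:R :> R by rewrite ltr0n.
move: p480 alpha_le; move: (480%:R : R) => c c0 le_alpha.
have sc : 0 < Num.sqrt c by rewrite sqrtr_gt0.
have sQ : 0 < Num.sqrt Q by rewrite sqrtr_gt0.
have den0 : 0 < Num.sqrt c * L * Num.sqrt Q by rewrite !mulr_gt0.
have : alpha ^+ 2 <= (delta / (Num.sqrt c * L * Num.sqrt Q)) ^+ 2.
  by rewrite lerXn2r ?nnegrE ?(ltW alpha_gt0)// ltW// divr_gt0.
rewrite expr_div_n !exprMn !sqr_sqrtr ?(ltW Q0) ?(ltW c0)// => h.
by rewrite -ler_pdivlMr// -mulrA -invfM.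
Qed.

Lemma stepsize_smooth : alpha * L <= 100^-1.
Proof.
have h := stepsize_sqr.
have d1 := delta_le1 lam tau_gt0; have d0 := delta_pos; have Q33 := Q_big.
have L2 : 0 < 480 * L ^+ 2.
  by apply: mulr_gt0; [rewrite ltr0n|exact: exprn_gt0].
rewrite (ler_pdivlMr _ _ L2) in h.
set s := alpha * L.
have hs : s ^+ 2 * (480 * Q) <= 1.
  apply: (@le_trans _ _ (delta ^+ 2)); last by rewrite expr_le1 ?(ltW d0).
  apply: le_trans h; rewrite le_eqVlt; apply/orP; left; apply/eqP.
  by rewrite /s; ring.
(* As Q >= 33, the product 480 * Q exceeds 100 ^ 2. *)
have hs' : s ^+ 2 * 10000 <= 1.
  apply: le_trans hs; apply: ler_wpM2l; first exact: sqr_ge0.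
  lra.
rewrite leNgt; apply/negP => s_gt.
have s2 : 100^-1 * 100^-1 < s * s by apply: ltr_pM => //; lra.
rewrite expr2 in hs'; lra.
Qed.

Lemma sum_gap_le K :
  \sum_(k < K) (D_ k + L / N%:R * C_ k) <=
  8 / (3 * alpha) * X_ 0%N + 40 * L / delta * (N%:R^-1 * V_ 0%N) +
  K%:R * (8 * alpha * sigma ^+ 2 / (3 * N%:R) +
          40 * alpha ^+ 2 * Q * L * sigma ^+ 2 / delta).
Proof.
set noise_floor := 8 * alpha * _ / _ + _.
have N0 : 0 < N%:R :> R by rewrite ltr0n.
have step k : D_ k + L / N%:R * C_ k <=
    8 / (3 * alpha) * (X_ k - X_ k.+1)
    + 40 * L / delta / N%:R * (V_ k - V_ k.+1) + noise_floor.
  rewrite -[40 * L / delta / N%:R * _]mulrA.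
  apply: (combine_recursions (M := Ex P (fun w => sqnorm (drift k w)))) => //.
  - by apply: Ex_ge0 => w; exact: favg_gap_ge0.
  - by apply: Ex_ge0 => w; exact: sqnorm_ge0.
  - exact: stepsize_smooth.
  - exact: stepsize_sqr.
  - by have := Q_big; lra.
  - exact: lyap_recursion.
  - exact: drift_le.
  - exact: avg_recursion.
have telescope := sum_telescope_le K step.
have X0 : 0 <= X_ K by apply: Ex_ge0 => w; exact: sqnorm_ge0.
have V0 : 0 <= V_ K.
  apply: Ex_ge0 => w; have q0 (Z : 'M[R]_(N, d)) : 0 <= q K Z by exact: qform_lyap_ge0.
  by rewrite addr_ge0// mulr_ge0.
apply: le_trans telescope _; rewrite lerD2r; apply: lerD.
  apply: ler_wpM2l; last by rewrite lerBlDr lerDl.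
  by rewrite divr_ge0// mulr_ge0// ltW.
rewrite [leRHS]mulrA; apply: ler_wpM2l; last by rewrite lerBlDr lerDl.
apply: divr_ge0; last exact: ltW.
apply: divr_ge0; last exact: ltW.
by apply: mulr_ge0 => //; exact: ltW.
Qed.

End GradientTracking.

Theorem theorem2 (R : realType) (N d : nat) (N_ge1 : (1 <= N)%N) (d_ge1 : (1 <= d)%N)
  (* probability space, sample spaces and distributions of the xi_i *)
  (dO : measure_display) (Omega : measurableType dO) (P : probability Omega R)
  (dX : measure_display) (Xi : 'I_N -> measurableType dX)
  (D : forall i : 'I_N, probability (Xi i) R)
  (* objectives *)
  (F : forall i : 'I_N, 'rV[R]_d -> Xi i -> R)
  (f : 'I_N -> 'rV[R]_d -> R)
  (F_diff : forall (i : 'I_N) (s : Xi i) (x : 'rV[R]_d),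
     differentiable (fun u => F i u s) x)
  (F_int : forall (i : 'I_N) (x : 'rV[R]_d),
     (D i).-integrable setT (EFin \o F i x))
  (f_def : forall (i : 'I_N) (x : 'rV[R]_d), (f i x)%:E = ('E_(D i)[F i x])%E)
  (f_diff : forall (i : 'I_N) (x : 'rV[R]_d), differentiable (f i) x)
  (* function assumption *)
  (L : R) (L_gt0 : 0 < L)
  (f_convex : forall i : 'I_N, convex_function [set: 'rV[R]_d] (f i))
  (f_smooth : forall i : 'I_N, smooth L (f i))
  (xstar : 'rV[R]_d)
  (xstar_min : forall x : 'rV[R]_d, favg f xstar <= favg f x)
  (* network assumption *)
  (W : nat -> 'M[R]_N) (tau : nat) (lam : R)
  (tau_ge1 : (1 <= tau)%N) (lam_ge0 : 0 <= lam) (lam_lt1 : lam < 1)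
  (W_network : network_assumption W tau lam)
  (* algorithm and gradient-noise assumption *)
  (alpha : R) (x0 : 'M[R]_(N, d))
  (xi : nat -> forall i : 'I_N, {mfun Omega >-> Xi i})
  (Fk : nat -> set (set Omega)) (sigma : R)
  (noise : noise_assumption F f W alpha x0 P xi Fk sigma)
  (alpha_gt0 : 0 < alpha)
  (alpha_le : alpha <=
     delta_cst tau lam / (Num.sqrt 480 * L * Num.sqrt (Q_cst tau lam)))
  (K : nat) (K_ge1 : (1 <= K)%N) :
  let x := xit F W alpha x0 xi in
  let delta := delta_cst tau lam in
  let Q := Q_cst tau lam in
  let X0 := Xtilde F W alpha x0 P xi xstar 0 in
  let E0 := Elyap F f W alpha x0 P xi tau lam xstar 0 in
  ((K%:R^-1)%:E *
     \sum_(k < K)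
       ('E_P[fun w => (favg f (rowavg (x k w)) - favg f xstar)%R] +
        (L / N%:R)%:E * 'E_P[fun w => sqnorm (centered (x k w))])
   <= (8 / (3 * alpha * K%:R))%:E * X0
      + (40 * L / (delta * K%:R))%:E * E0
      + (8 * alpha * sigma ^+ 2 / (3 * N%:R))%:E
      + (40 * alpha ^+ 2 * Q * L * sigma ^+ 2 / delta)%:E)%E.
Proof.
cbv zeta; set x := xit F W alpha x0 xi.
set delta := delta_cst tau lam; set Q := Q_cst tau lam.
set X0 := Xtilde _ _ _ _ _ _ _ _; set E0 := Elyap _ _ _ _ _ _ _ _ _ _ _.
have alpha0 : alpha != 0 by rewrite gt_eqF.
have F_meas i u : measurable_fun setT (F i u : Xi i -> R).
  by apply: intble_measurable (D i) _ _; exact: F_int.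
have intgap := intble_gap N_ge1 f_diff L_gt0 f_smooth xstar_min noise.
have intC k : intble P (fun w => sqnorm (centered (x k w))).
  exact: intble_sqnorm (sqint_centered f_diff L_gt0 f_smooth noise k).
have intX0 : intble P (fun w => sqnorm (rowavg (x 0%N w) - xstar)).
  exact: (intble_cst P (sqnorm (rowavg x0 - xstar))).
have intE0 := intble_lyap f_diff L_gt0 f_smooth xstar tau lam noise 0.
have -> : X0 = (Ex P (fun w => sqnorm (rowavg (x 0%N w) - xstar)))%:E.
  exact: expectation_intble.
rewrite /E0 /Elyap (expectation_intble intE0).
under eq_bigr do rewrite (expectation_intble (intgap _)) (expectation_intble (intC _)) -EFinM -EFinD.
rewrite sumEFin -!EFinM -!EFinD lee_fin.
have := sum_gap_le N_ge1 F_diff F_meas f_diff L_gt0 f_convex f_smooth xstar_min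
  tau_ge1 lam_ge0 lam_lt1 W_network alpha_gt0 noise alpha_le K.
have K0 : 0 < K%:R :> R by rewrite ltr0n.
rewrite -(ler_pM2l (_ : 0 < K%:R^-1 :> R)) ?invr_gt0// => h.
apply: le_trans h _; rewrite le_eqVlt; apply/orP; left; apply/eqP.
rewrite -/delta -/Q.
have d0 : delta != 0 by rewrite gt_eqF// delta_gt0.
have N0 : N%:R != 0 :> R by rewrite pnatr_eq0 -lt0n.
by field; rewrite alpha0 d0 N0 gt_eqF.
Qed.
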